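(* Let $p(\cdot),q(\cdot)\in\mathcal{P}$ satisfy $1<p_-\le p_+<\infty$ and $1<q_-\le q_+<\infty$, and assume that $\ell^{q(\cdot)}(L^{p(\cdot)})$, equipped with $\|\cdot\|_{\ell^{q(\cdot)}(L^{p(\cdot)})}$, is a Banach space. Then $\ell^{q(\cdot)}(L^{p(\cdot)})$ is strictly convex.
   Context: Exponents: $\mathcal{P}$ is the set of measurable functions $p(\cdot):\mathbb{R}^n\to[1,\infty]$; $p_-=\operatorname{ess\,inf}p$, $p_+=\operatorname{ess\,sup}p$ (similarly $q_\pm$). Variable Lebesgue space: with $\Omega_\infty=\{x:p(x)=\infty\}$ and $\Omega_0=\mathbb{R}^n\setminus\Omega_\infty$, put $\varrho_{p(\cdot)}(f)=\int_{\Omega_0}|f(x)|^{p(x)}dx+\|f\|_{L^\infty(\Omega_\infty)}$; $L^{p(\cdot)}=L^{p(\cdot)}(\mathbb{R}^n)$ is the set of measurable $f$ with $\varrho_{p(\cdot)}(f/\lambda)<\infty$ for some $\lambda>0$, and $\|f\|_{p(\cdot)}=\inf\{\lambda>0:\varrho_{p(\cdot)}(f/\lambda)\le1\}$. Mixed space: for a sequence $f=(f_\nu)_{\nu\ge1}$ with $f_\nu\in L^{p(\cdot)}$, put $\varrho_{\ell^{q(\cdot)}(L^{p(\cdot)})}(f)=\sum_{\nu=1}^\infty\inf\{\lambda_\nu>0:\varrho_{p(\cdot)}(f_\nu/\lambda_\nu^{1/q(\cdot)})\le1\}$ (convention $\lambda^{1/\infty}=1$). When $q_+<\infty$ this equals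 $\sum_\nu\||f_\nu|^{q(\cdot)}\|_{p(\cdot)/q(\cdot)}$. The space $\ell^{q(\cdot)}(L^{p(\cdot)})$ is the set of such $f$ with $\varrho_{\ell^{q(\cdot)}(L^{p(\cdot)})}(f/\lambda)<\infty$ for some $\lambda>0$, with (quasi-)norm $\|f\|_{\ell^{q(\cdot)}(L^{p(\cdot)})}=\inf\{\mu>0:\varrho_{\ell^{q(\cdot)}(L^{p(\cdot)})}(f/\mu)\le1\}$. A Banach space $X$ is strictly convex if $\|x+y\|<2$ for any two distinct vectors $x,y$ in its unit ball. *)

(* Defs.v *)
From HB Require Import structures.
From mathcomp Require Import all_boot all_order all_algebra.
From mathcomp Require Import all_classical all_reals all_analysis.
From mathcomp Require Import measurable_realfun ess_sup_inf.

Set Implicit Arguments.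
Unset Strict Implicit.
Unset Printing Implicit Defensive.

Import Order.TTheory GRing.Theory Num.Theory.
Import numFieldNormedType.Exports.

Local Open Scope classical_set_scope.
Local Open Scope ring_scope.

(* Lebesgue measure on R^(n+1), so that the dimension is at least 1: the outer
   measure is the infimum of the total volumes of the countable covers by closed
   boxes, and the (complete) Lebesgue sigma-algebra is that of its
   Caratheodory-measurable sets. *)

Section lebesgue_outer_measure.
Context {R : realType} {n : nat}.
Local Notation Rn := 'rV[R]_n.+1.

Definition box (b : Rn * Rn) : set Rn :=
  [set x | forall i, b.1 0 i <= x 0 i <= b.2 0 i].

Definition box_volume (b : Rn * Rn) : R :=
  \prod_(i < n.+1) Num.max 0 (b.2 0 i - b.1 0 i).

Definition lebesgue_outer (A : set Rn) : \bar R :=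
  ereal_inf [set (\sum_(0 <= k <oo) (box_volume (b k))%:E)%E |
             b in [set b : nat -> Rn * Rn | A `<=` \bigcup_k box (b k)]].

Local Open Scope ereal_scope.

Let vol (b : Rn * Rn) : \bar R := (box_volume b)%:E.

Let vol_ge0 b : 0 <= vol b.
Proof.
rewrite /vol lee_fin; apply: prodr_ge0 => i _.
by rewrite le_max lexx.
Qed.

Let lebesgue_outer_ge0 A : 0 <= lebesgue_outer A.
Proof.
apply: le_ereal_inf_tmp => x [b _ <-{x}].
by apply: nneseries_ge0 => k _ _; exact: vol_ge0.
Qed.

Let lebesgue_outer0 : lebesgue_outer set0 = 0.
Proof.
apply/eqP; rewrite eq_le lebesgue_outer_ge0 andbT.
apply: ereal_inf_lbound; exists (fun=> (0%R, 0%R)) => //=.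
apply: eseries0 => k _ _.
by rewrite /box_volume big_ord_recl /= subrr maxxx mul0r.
Qed.

Let le_lebesgue_outer : {homo lebesgue_outer : A B / A `<=` B >-> A <= B}.
Proof.
move=> A B AB; apply/ereal_inf_le_tmp => x [b Bb <-{x}].
by exists b => //; exact: subset_trans Bb.
Qed.

Let lebesgue_outer_sigma_subadditive : sigma_subadditive lebesgue_outer.
Proof.
move=> A; have [[i ioo]|] := pselect (exists i, lebesgue_outer (A i) = +oo).
  rewrite (eseries_pinfty _ _ ioo) ?leey// => m _.
  by rewrite -ltNye (lt_le_trans _ (lebesgue_outer_ge0 _)).
rewrite -forallNE => Aoo.
suff add2e (e : {posnum R}) : lebesgue_outer (\bigcup_n A n) <=
    \sum_(i <oo) lebesgue_outer (A i) + e%:num%:E.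
  by apply/lee_addgt0Pr => _/posnumP[].
have outerA_ge0 m : 0 <= lebesgue_outer (A m) by exact: lebesgue_outer_ge0.
apply: le_trans (epsilon_trick _ outerA_ge0 _) => //.
pose P m (b : nat -> Rn * Rn) := A m `<=` \bigcup_k box (b k) /\
  \sum_(k <oo) vol (b k) <= lebesgue_outer (A m) + (e%:num / (2 ^ m.+1)%:R)%:E.
have [G PG] : {G : nat -> nat -> Rn * Rn & forall m, P m (G m)}.
  apply: (@choice _ _ P) => m; rewrite /P /lebesgue_outer.
  set S := (X in ereal_inf X); move infS : (ereal_inf S) => iS.
  case: iS infS => [r Sr|Soo|Soo].
  - have em1 : (0 < e%:num / (2 ^ m.+1)%:R)%R by [].
    have /(lb_ereal_inf_adherent em1) : ereal_inf S \is a fin_num by rewrite Sr.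
    move=> [x [b Ab bx] xS].
    by exists b; split => //; rewrite -Sr /vol bx; exact/ltW.
  - by have := Aoo m; rewrite /lebesgue_outer Soo.
  - suff : lbound S 0 by move/le_ereal_inf_tmp; rewrite Soo.
    by move=> /= _ [b _ <-]; apply: nneseries_ge0 => k _ _; exact: vol_ge0.
apply: (@le_trans _ _ (\esum_(i in setT) (vol \o uncurry G) i)).
  apply: ereal_inf_lbound => /=.
  have /card_esym/ppcard_eqP[f] := card_nat2.
  exists (uncurry G \o f).
    move=> t [i _ Ait]; have [j _ ?] := (PG i).1 _ Ait.
    by exists (f^-1%FUN (i, j)) => //=; rewrite invK ?inE.
  rewrite -(esum_pred_image (vol \o uncurry G) _ xpredT) ?[fun=> _]set_true//.
  - by rewrite image_eq.
  - by move=> ? _; exact: vol_ge0.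
have -> : \esum_(i in setT) (vol \o uncurry G) i =
    \sum_(i <oo) \sum_(j <oo) vol (G i j).
  pose J : nat -> set (nat * nat) := fun i => [set (i, j) | j in setT].
  have -> : [set: nat * nat] = \bigcup_k J k.
    by rewrite predeqE => -[a b]; split => // _; exists a => //; exists b.
  rewrite esum_bigcupT /=; last 2 first.
  - apply/trivIsetP => i j _ _ ij.
    rewrite predeqE => -[k m] /=; split => //= -[] [_] _ [<-{k} _].
    by move=> [m' _] [] /esym/eqP; rewrite (negbTE ij).
  - by move=> ?; exact: vol_ge0.
  rewrite -(image_id [set: nat]) -fun_true esum_pred_image//; last first.
    by move=> k _; apply: esum_ge0 => ? _; exact: vol_ge0.
  apply: eq_eseriesr => /= j _.
  rewrite -(esum_pred_image (vol \o uncurry G) (pair j) predT)//=.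
  - by congr esum; rewrite predeqE => -[a b]; split; move=> [i _ <-]; exists i.
  - by move=> ? ? _ _; exact: (@can_inj _ _ _ snd).
apply: lee_nneseries => [i _ _|i _].
- by apply: nneseries_ge0 => k _ _; exact: vol_ge0.
- exact: (PG i).2.
Qed.

HB.instance Definition _ := isOuterMeasure.Build R Rn lebesgue_outer
  lebesgue_outer0 lebesgue_outer_ge0 le_lebesgue_outer
  lebesgue_outer_sigma_subadditive.

End lebesgue_outer_measure.
Arguments lebesgue_outer R n : clear implicits.

Definition lebesgue_space (R : realType) (n : nat) :=
  caratheodory_type (lebesgue_outer R n).

HB.instance Definition _ (R : realType) (n : nat) :=
  Measurable.on (lebesgue_space R n).

Definition lebesgue (R : realType) (n : nat) :
    set (lebesgue_space R n) -> \bar R := lebesgue_outer R n.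
Arguments lebesgue : clear implicits.

HB.instance Definition _ (R : realType) (n : nat) :=
  isMeasure.Build _ (lebesgue_space R n) R (lebesgue R n)
    (@caratheodory_measure0 _ _ (lebesgue_outer R n))
    (@caratheodory_measure_ge0 _ _ (lebesgue_outer R n))
    (@caratheodory_measure_sigma_additive _ _ (lebesgue_outer R n)).

Section variable_exponent_spaces.
Context {d : measure_display} {T : measurableType d} {R : realType}.
Variable mu : {measure set T -> \bar R}.
Implicit Types (p q : T -> \bar R).

(* The infimum in \bar R is +oo when no positive real satisfies P. *)
Definition inf_pos (P : R -> Prop) : \bar R :=
  ereal_inf [set l%:E | l in [set l : R | 0 < l /\ P l]].

Definition variable_exponent p :=
  measurable_fun [set: T] p /\ forall x, (1%:E <= p x)%E.

Definition Omega_infty p : set T := [set x | p x = +oo%E].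
Definition Omega_zero p : set T := ~` Omega_infty p.

(* The L^oo norm on Omega_infty is that of the extension by 0. *)
Definition modular p (f : T -> R) : \bar R :=
  (\int[mu]_(x in Omega_zero p) (`|f x| `^ fine (p x))%:E +
   'N[mu]_(+oo)[(EFin \o f) \_ (Omega_infty p)])%E.

Definition Lvar p (f : T -> R) : Prop :=
  measurable_fun [set: T] f /\
  exists l : R, 0 < l /\ (modular p (fun x => f x / l)%R < +oo)%E.

(* l ^ (1 / q), with l ^ (1 / oo) = 1. *)
Definition root_exponent (l : R) (e : \bar R) : R :=
  if e is r%:E then l `^ r^-1 else 1.

(* Sequences are indexed from 0 rather than from 1. *)
Definition mixed_modular p q (f : nat -> T -> R) : \bar R :=
  (\sum_(0 <= nu <oo)
    inf_pos (fun l =>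
      modular p (fun x => f nu x / root_exponent l (q x))%R <= 1))%E.

Definition mixed_space p q (f : nat -> T -> R) : Prop :=
  (forall nu, Lvar p (f nu)) /\
  exists l : R, 0 < l /\
    (mixed_modular p q (fun nu x => f nu x / l)%R < +oo)%E.

Definition mixed_norm p q (f : nat -> T -> R) : \bar R :=
  inf_pos (fun m => mixed_modular p q (fun nu x => f nu x / m)%R <= 1)%E.

(* The elements of the space are the classes of sequences modulo equality
   almost everywhere. The Banach space V is that space, normed by mixed_norm,
   when cls identifies the set of these classes with V. Such V and cls exist
   if and only if the space of classes, with this norm, is a Banach space. *)
Definition is_mixed_banach_space p q
    (V : completeNormedModType R) (cls : (nat -> T -> R) -> V) : Prop :=
  [/\ forall (a : R) f g, mixed_space p q f -> mixed_space p q g ->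
        mixed_space p q (fun nu x => a * f nu x + g nu x) /\
        cls (fun nu x => a * f nu x + g nu x) = a *: cls f + cls g,
      forall v, exists2 f, mixed_space p q f & cls f = v,
      forall f g, mixed_space p q f -> mixed_space p q g ->
        cls f = cls g <->
        forall nu, ae_eq mu [set: T] (f nu) (g nu) &
      forall f, mixed_space p q f -> (`|cls f|)%:E = mixed_norm p q f].

End variable_exponent_spaces.

Definition strictly_convex (R : realType) (V : normedModType R) : Prop :=
  forall x y : V, `|x| <= 1 -> `|y| <= 1 -> x != y -> `|x + y| < 2.

(* Main.v *)
Require Import Defs.
From mathcomp Require Import all_boot all_order all_algebra.
From mathcomp Require Import all_classical all_reals all_analysis.
From mathcomp Require Import measurable_realfun ess_sup_inf.
From mathcomp Require Import ring lra.

(** Write U = 1/q. The norm is governed by the sum of the terms phi (f_nu),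
    where phi f is the infimum of the l > 0 with
    [int |f|^P l^(-P U) <= 1]: as the exponents are bounded, norm at most 1
    means that this sum is at most 1, and norm 1 forces it to be 1.

    For general exponents such a unit ball is not convex. What the Banach
    hypothesis provides is that phi itself is convex ([phi_convex]). Indeed
    phi is homogeneous along the linear maps f |-> c^U f, in that
    phi (c^U f) = c phi f; so two functions a, b may be rescaled until
    phi a + phi b is at most 1, and then (a, b, 0, ...) and (b, a, 0, ...)
    lie in the unit ball. Their midpoint has two equal terms
    phi ((a + b)/2), and it lies in the unit ball too.

    Suppose now that x and y are distinct points of the unit ball with
    |x + y| = 2. The segment from x to y lies on the unit sphere, and since the
    convexity inequalities of the coordinates add up to an equality, each
    coordinate term l_t = phi (W_t), where W_t = f_nu + t (g_nu - f_nu), is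
    affine in t. It remains to see that phi is not affine along any
    nonconstant segment ([phi_affine_rigid]).

    A convex function that is affine along a segment has the same gradient at
    all interior points of the segment ([grad_proportional]). The gradient of
    phi at W_t is proportional to |W_t|^(P-1) sgn (W_t) l_t^(-P U). Fix an
    interior time s, let r_t = W_t / W_s and let G_t be the ratio of the
    proportionality constants at times t and s. Almost everywhere on the
    support,
      r_t^(P-1) G_t = (l_t / l_s)^(P U).
    Here r_t and l_t are affine in t. So is G_t, because multiplying by W_t and
    integrating identifies G_t with the average of r_t for the probability
    density |W_s|^P l_s^(-P U). Comparing the logarithmic derivatives of the
    two sides ([affine_power_identity]), which are rational functions of t,
    and using P > 1 and 0 < U < 1, leaves two possibilities: either l_t and r_t
    are constant, or l_t is not constant and one of r_t, G_t is constant
    while the other one is l_t / l_s. The second contradicts that G_t is the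
    average of r_t. Hence W_t does not depend on t, and f_nu = g_nu almost
    everywhere. *)

Set Implicit Arguments.
Unset Strict Implicit.
Unset Printing Implicit Defensive.

Import Order.TTheory GRing.Theory Num.Theory.
Import numFieldNormedType.Exports.

Local Open Scope classical_set_scope.
Local Open Scope ring_scope.

(** * Inequalities and identities between real powers *)

Section real_inequalities.
Context {R : realType}.
Implicit Types (x y s : R).

Lemma powR_expR x s : 0 < x -> x `^ s = expR (s * ln x).
Proof. by move=> x0; rewrite /powR gt_eqF. Qed.

Lemma powR_gt1 x s : 1 < x -> 0 < s -> 1 < x `^ s.
Proof.
move=> x1 s0; rewrite powR_expR ?(lt_trans _ x1) // expR_gt1.
by rewrite mulr_gt0 // ln_gt0.
Qed.

Lemma expR_le_quadratic y : y <= 2^-1 -> expR y <= 1 + y + 2 * y ^+ 2.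
Proof.
move=> y2; have y1 : 0 < 1 - y by lra.
have : expR (- y) >= 1 - y by exact: expR_ge1Dx.
rewrite expRN => h; apply: (@le_trans _ _ (1 - y)^-1).
  by rewrite -[leLHS]invrK lef_pV2 // posrE invr_gt0 expR_gt0.
rewrite -[leLHS]mul1r ler_pdivrMr //.
nra.
Qed.

Lemma expR_le_affine s : - 2^-1 <= s -> expR (s - 2 * s ^+ 2) <= 1 + s.
Proof.
move=> s2; have s1 : 0 < 1 + s by lra.
apply: (@le_trans _ _ (expR (s / (1 + s)))).
  rewrite ler_expR ler_pdivlMr //; nra.
have : expR (- (s / (1 + s))) >= 1 - s / (1 + s) by exact: expR_ge1Dx.
have -> : 1 - s / (1 + s) = (1 + s)^-1 by field; rewrite gt_eqF.
by rewrite expRN lef_pV2 // posrE expR_gt0.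
Qed.

(** First-order expansion, in eps, of the factor by which the density
    |f|^p l^(-p u) is multiplied when f becomes (1 + eps e) f and l becomes
    (1 + eps b) l. The quadratic error is uniform in p <= M, u <= 1 and
    |e| <= 1, so that the bound survives integration. *)
Lemma perturbation_bound (p u e b eps M : R) :
  let B := M * (1 + `|b| + 2 * b ^+ 2) in
  1 <= M -> 0 <= p <= M -> 0 <= u <= 1 -> `|e| <= 1 ->
  0 < eps -> eps * B <= 2^-1 ->
  (1 + eps * e) `^ p * (1 + eps * b) `^ (- (p * u)) <=
  1 + eps * (p * (e - u * b)) + eps ^+ 2 * (2 * M * b ^+ 2 + 2 * B ^+ 2).
Proof.
move=> B M1 /andP[p0 pM] /andP[u0 u1] e1 eps0 epsB.
have B1 : 1 <= B by rewrite /B; have := normr_ge0 b; nra.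
have Bb : `|b| <= B by rewrite /B; have := normr_ge0 b; nra.
have [eb_le eb_ge] : eps * b <= 2^-1 /\ - 2^-1 <= eps * b.
  move: Bb; rewrite ler_norml => /andP[]; nra.
have [ee_le ee_ge] : eps * e <= 2^-1 /\ - 2^-1 <= eps * e.
  move: e1; rewrite ler_norml => /andP[]; nra.
have h1 : (1 + eps * e) `^ p <= expR (p * (eps * e)).
  rewrite powR_expR; last lra.
  rewrite ler_expR; apply: ler_wpM2l => //.
  by apply: (le_trans (le_ln1Dx _)) => //; lra.
have h2 : (1 + eps * b) `^ (- (p * u)) <=
    expR (- (p * u) * (eps * b - 2 * (eps * b) ^+ 2)).
  rewrite powR_expR; last lra.
  rewrite ler_expR !mulNr lerN2; apply: ler_wpM2l; first exact: mulr_ge0.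
  rewrite -ler_expR lnK ?posrE; last lra.
  by apply: expR_le_affine; lra.
apply: (le_trans (ler_pM (powR_ge0 _ _) (powR_ge0 _ _) h1 h2)).
rewrite -expRD.
set w := p * (e - u * b) + eps * (2 * p * u * b ^+ 2).
have -> : p * (eps * e) + - (p * u) * (eps * b - 2 * (eps * b) ^+ 2) = eps * w.
  by rewrite /w; ring.
have eps1 : eps <= 1 by nra.
have pu0 : 0 <= p * u by exact: mulr_ge0.
have puM : p * u <= M by nra.
have wB : `|w| <= B.
  rewrite /w; apply: (le_trans (ler_normD _ _)).
  have s0 : 0 <= eps * (2 * p * u * b ^+ 2).
    by rewrite mulr_ge0 ?(ltW eps0) // mulr_ge0 ?sqr_ge0 // -mulrA mulr_ge0.
  rewrite (ger0_norm s0) normrM (ger0_norm p0).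
  have h : `|e - u * b| <= 1 + `|b|.
    apply: (le_trans (ler_normB _ _)); rewrite normrM (ger0_norm u0).
    by apply: lerD => //; have := normr_ge0 b; nra.
  have h3 : p * `|e - u * b| <= M * (1 + `|b|).
    by apply: ler_pM.
  have h4 : eps * (2 * p * u * b ^+ 2) <= M * (2 * b ^+ 2).
    have : eps * (p * u) <= 1 * M by apply: ler_pM => //; exact: ltW.
    by move=> /(ler_wpM2r (sqr_ge0 b)); lra.
  rewrite /B; lra.
have : eps * w <= 2^-1.
  by apply: le_trans epsB; rewrite ler_pM2l //; apply: le_trans wB; exact: ler_norm.
move=> /expR_le_quadratic /le_trans; apply.
have wB2 : w ^+ 2 <= B ^+ 2.
  by rewrite -[w ^+ 2]real_normK ?num_real // ler_sqr ?nnegrE //; lra.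
have h5 : eps * (2 * p * u * b ^+ 2) <= eps * (2 * M * b ^+ 2).
  by rewrite ler_pM2l //; have := ler_wpM2r (sqr_ge0 b) puM; lra.
have e2 : 0 < eps ^+ 2 by rewrite exprn_gt0.
have h6 := ler_wpM2l (ltW e2) wB2.
have h7 := ler_wpM2l (ltW eps0) h5.
rewrite /w in h6 h7 *.
lra.
Qed.

(** The logarithmic derivatives of both sides are rational functions of t;
    after clearing denominators their difference is the quadratic polynomial
    A + B t + C t^2 of the proof. Four values of t where the identity holds
    (t = 0 is automatic) give three zeros of that polynomial by Rolle's theorem,
    hence A = B = C = 0. *)
Lemma affine_power_identity (p u rho gam dlt : R) :
  1 < p -> 0 < u < 1 ->
  0 < 1 + rho * 3 -> 0 < 1 + gam * 3 -> 0 < 1 + dlt * 3 ->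
  (forall t, t \in [:: 1; 2; 3] ->
    (1 + rho * t) `^ (p - 1) * (1 + gam * t) = (1 + dlt * t) `^ (p * u)) ->
  (dlt = 0 /\ rho = 0) \/
  (dlt != 0 /\ (gam = 0 /\ rho = dlt \/ gam = dlt /\ rho = 0)).
Proof.
move=> p1 /andP[u0 u1] r3 g3 d3 tE.
have pos (k t : R) : 0 < 1 + k * 3 -> 0 <= t <= 3 -> 0 < 1 + k * t.
  by move=> k3 /andP[t0 t3]; have [k0|k0] := leP 0 k; nra.
pose F (t : R) := (p - 1) * ln (1 + rho * t) + ln (1 + gam * t)
            - p * u * ln (1 + dlt * t).
have F0 : F 0 = 0 by rewrite /F !mulr0 !addr0 ln1; ring.
have Ft (t : R) : t \in [:: 1; 2; 3] -> F t = 0.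
  move=> tt; have t03 : 0 <= t <= 3.
    by move: tt; rewrite !inE => /or3P[] /eqP ->; lra.
  have /(congr1 (@ln R)) := tE t tt.
  have rt := pos _ _ r3 t03; have gt_ := pos _ _ g3 t03.
  rewrite lnM ?posrE ?powR_gt0 // !ln_powR => h.
  by rewrite /F h subrr.
have dlin (k t : R) : 0 < 1 + k * 3 -> 0 <= t <= 3 ->
    is_derive t 1 (fun t => ln (1 + k * t)) ((1 + k * t)^-1 * k).
  move=> k3 t03; apply: (@is_derive1_comp _ (@ln R) (fun t => 1 + k * t)).
    by apply: is_derive1_ln; exact: pos.
  apply: (is_derive_eq (is_deriveD (is_derive_cst (1 : R) t 1)
    (is_deriveZ k (is_derive_id t 1)))).
  by rewrite add0r /GRing.scale /= mulr1.
pose dF (t : R) := (p - 1) * ((1 + rho * t)^-1 * rho) + (1 + gam * t)^-1 * gam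
   - p * u * ((1 + dlt * t)^-1 * dlt).
have FdF (t : R) : 0 <= t <= 3 -> is_derive t 1 F (dF t).
  move=> t03; have d1 := dlin _ _ r3 t03; have d2 := dlin _ _ g3 t03.
  have d3' := dlin _ _ d3 t03.
  have e1 := is_deriveZ (p - 1) d1; have e3 := is_deriveZ (p * u) d3'.
  exact: is_deriveB (is_deriveD e1 d2) e3.
pose A := (p - 1) * rho + gam - p * u * dlt.
pose B := (p - 1) * rho * (gam + dlt) + gam * (rho + dlt)
          - p * u * dlt * (rho + gam).
pose C := p * (1 - u) * (rho * gam * dlt).
have zero (a : R) : 0 <= a <= 2 -> F a = 0 -> F (a + 1) = 0 ->
    exists2 c, a < c < a + 1 & A + B * c + C * c ^+ 2 = 0.
  move=> a02 Fa Fb.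
  have sub (x : R) : a <= x <= a + 1 -> 0 <= x <= 3 by lra.
  have [||||c] := @Rolle R F a (a + 1).
  - lra.
  - move=> x; rewrite in_itv /= => xab.
    have /FdF[] // : 0 <= x <= 3 by apply: sub; lra.
  - apply: derivable_within_continuous => x; rewrite in_itv /= => xab.
    by have /FdF[] // : 0 <= x <= 3 by apply: sub; lra.
  - by rewrite Fa Fb.
  rewrite in_itv /= => cab dc; exists c => //.
  have c03 : 0 <= c <= 3 by apply: sub; lra.
  have : dF c = 0.
    have [_ <-] := FdF c c03; by have [_ ->] := dc.
  have rc := pos _ _ r3 c03; have gc := pos _ _ g3 c03.
  have dc' := pos _ _ d3 c03.
  move=> dF0.
  have -> : A + B * c + C * c ^+ 2 =
      dF c * ((1 + rho * c) * (1 + gam * c) * (1 + dlt * c)).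
    by rewrite /dF /A /B /C; field; rewrite !gt_eqF.
  by rewrite dF0 mul0r.
have [|||c1 c1i q1] := zero 0; rewrite ?add0r //; [lra|by apply: Ft; rewrite !inE eqxx ?orbT|].
have [|||c2 c2i q2] := zero 1; [lra|by apply: Ft; rewrite !inE eqxx ?orbT| |].
  by apply: Ft; rewrite !inE eqxx ?orbT.
have [|||c3 c3i q3] := zero 2; [lra|by apply: Ft; rewrite !inE eqxx ?orbT| |].
  by rewrite (_ : 2 + 1 = 3); [apply: Ft; rewrite !inE eqxx ?orbT|ring].
have n12 : c2 - c1 != 0 by apply/eqP; lra.
have n13 : c3 - c1 != 0 by apply/eqP; lra.
have n23 : c3 - c2 != 0 by apply/eqP; lra.
have l12 : B + C * (c1 + c2) = 0 by apply: (mulfI n12); rewrite mulr0; lra.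
have l13 : B + C * (c1 + c3) = 0 by apply: (mulfI n13); rewrite mulr0; lra.
have C0 : C = 0 by apply: (mulfI n23); rewrite mulr0; lra.
have B0 : B = 0 by rewrite C0 in l12; lra.
have A0 : A = 0 by rewrite C0 B0 in q1; lra.
have pu_gt0 : p * u != 0 by rewrite gt_eqF // mulr_gt0 //; lra.
have p1_neq0 : p - 1 != 0 by rewrite gt_eqF //; lra.
have u1_neq0 : p * (1 - u) != 0 by rewrite gt_eqF // mulr_gt0 //; lra.
have /eqP := C0; rewrite /C mulf_eq0 (negbTE u1_neq0) /= => /eqP rgd.
have [d0|dn0] := eqVneq dlt 0.
  left; split => //.
  have gE : gam = - ((p - 1) * rho) by rewrite /A d0 in A0; lra.
  have : p * (p - 1) * (rho ^+ 2) = 0.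
    rewrite /B d0 gE in B0.
    transitivity (- ((p - 1) * rho * (- ((p - 1) * rho) + 0) +
       - ((p - 1) * rho) * (rho + 0) - p * u * 0 * (rho + - ((p - 1) * rho)))).
      by ring.
    by rewrite B0 oppr0.
  move/eqP; rewrite !mulf_eq0 (negbTE p1_neq0) orbF gt_eqF ?lra //=; last lra.
  by rewrite orbb => /eqP.
right; split => //.
have /eqP := rgd; rewrite !mulf_eq0 (negbTE dn0) orbF => /orP[/eqP r0|/eqP g0].
  right; split => //.
  have gE : gam = p * u * dlt by rewrite /A r0 in A0; lra.
  have gn0 : gam != 0 by rewrite gE mulf_neq0.
  apply: (mulfI gn0).
  have : gam * dlt = p * u * dlt * gam by rewrite /B r0 in B0; lra.
  by rewrite -gE => ->.
left; split => //.
have rE : (p - 1) * rho = p * u * dlt by rewrite /A g0 in A0; lra.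
have rn0 : rho != 0.
  apply: contra_neq (mulf_neq0 pu_gt0 dn0) => r0.
  by rewrite -rE r0 mulr0.
have : (p - 1) * rho * dlt = p * u * dlt * rho by rewrite /B g0 in B0; lra.
rewrite -rE => h; apply/esym; apply: (@mulfI _ ((p - 1) * rho)).
  exact: mulf_neq0.
exact: h.
Qed.

Lemma affine_gt0 (r : R) (i : nat) : 0 < 1 + r * 3 -> (i < 4)%N -> 0 < 1 + r * i%:R.
Proof. by move=> r3; case: i => [|[|[|[|]]]] // _; lra. Qed.

(** The relation between gradients, read at one point: [w k] is the value of
    the affine function there at time k/8, [L k] the value of phi and [c k] the
    normalisation of the gradient. Equality of gradients forces the signs of
    the nonzero [w k] to agree, and an affine function with a zero strictly
    between two of these times changes sign there unless it is zero. This is why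
    one time on each side of the four times 2, ..., 5 is needed. *)
Lemma pointwise_rigidity (p u A B : R) (w c L : nat -> R) :
  1 < p ->
  (forall k, w k = A + k%:R * B) ->
  (forall k, (0 < k < 7)%N -> 0 < c k /\ 0 < L k) ->
  (forall k l, (0 < k < 7)%N -> (0 < l < 7)%N -> w k != 0 -> w l != 0 ->
    c k * (p * (`|w k| `^ (p - 1) * Num.sg (w k)) * L k `^ (- (p * u))) =
    c l * (p * (`|w l| `^ (p - 1) * Num.sg (w l)) * L l `^ (- (p * u)))) ->
  (A = 0 /\ B = 0) \/
  [/\ w 2%N != 0, 0 < 1 + B / w 2%N * 3 &
    forall i, (i < 4)%N -> w i.+2 = w 2%N * (1 + B / w 2%N * i%:R) /\
      (1 + B / w 2%N * i%:R) `^ (p - 1) * (c i.+2 / c 2%N) =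
      (L i.+2 / L 2%N) `^ (p * u)].
Proof.
move=> p1 wdef pos prop.
have sgE k l : (0 < k < 7)%N -> (0 < l < 7)%N -> w k != 0 -> w l != 0 ->
    Num.sg (w k) = Num.sg (w l).
  move=> k7 l7 wk wl; have := congr1 Num.sg (prop k l k7 l7 wk wl).
  have [ck Lk] := pos _ k7; have [cl Ll] := pos _ l7.
  have p0 : 0 < p by lra.
  have sgpow (v : R) : v != 0 -> Num.sg (`|v| `^ (p - 1)) = 1.
    by move=> v0; apply/gtr0_sg/powR_gt0; rewrite normr_gt0.
  rewrite !sgrM !sgr_id !sgpow // (gtr0_sg ck) (gtr0_sg cl) (gtr0_sg p0).
  rewrite (gtr0_sg (powR_gt0 _ Lk)) (gtr0_sg (powR_gt0 _ Ll)).
  by rewrite !(mul1r, mulr1).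
have [AB|nAB] := pselect (A = 0 /\ B = 0); first by left.
right.
have wn0 k : (1 < k < 6)%N -> w k != 0.
  move=> /andP[k1 k6]; apply/eqP => wk0.
  case: k k1 k6 wk0 => // k k1 k6 wk0.
  have wm : w k = - B.
    by move: wk0; rewrite !wdef -natr1; lra.
  have wp : w k.+2 = B.
    by move: wk0; rewrite !wdef -!natr1; lra.
  have [B0|B0] := eqVneq B 0.
    by apply: nAB; split => //; move: wk0; rewrite wdef B0 mulr0 addr0.
  have k7 : (0 < k < 7)%N by apply/andP; split => //; do 2 apply: ltnW.
  have k27 : (0 < k.+2 < 7)%N by rewrite ltnS.
  have := sgE k k.+2 k7 k27; rewrite wm wp oppr_eq0 B0 => /(_ isT isT).
  rewrite sgrN => h.
  have : Num.sg B = 0 by lra.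
  by move/eqP; rewrite sgr_eq0 (negbTE B0).
have w2 : w 2%N != 0 by exact: wn0.
set r := B / w 2%N.
have wE i : w i.+2 = w 2%N * (1 + r * i%:R).
  by rewrite /r mulrDr mulr1 mulrA mulrCA divff // mulr1 !wdef -!natr1; ring.
have rpos i : (i < 4)%N -> 0 < 1 + r * i%:R.
  move=> i4; have wi : w i.+2 != 0 by apply: wn0; rewrite !ltnS.
  have := sgE i.+2 2%N; rewrite wi w2 => /(_ _ isT isT isT).
  rewrite !ltnS (ltnW i4) => /(_ isT).
  rewrite wE sgrM -[RHS]mulr1 => /mulfI; rewrite sgr_eq0 => /(_ w2) h.
  by rewrite -sgr_gt0 h.
split => //; first exact: (rpos 3%N).
move=> i i4; split => //.
have ri := rpos i i4.
have i7 : (0 < i.+2 < 7)%N by rewrite !ltnS (ltnW i4).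
have [c2 L2] := pos 2%N isT; have [ci Li] := pos _ i7.
have wi : w i.+2 != 0 by apply: wn0; rewrite !ltnS.
have sE := sgE i.+2 2%N i7 isT wi w2.
have := prop i.+2 2%N i7 isT wi w2.
rewrite sE wE normrM (gtr0_norm ri) (powRM _ (normr_ge0 _) (ltW ri)).
set s := Num.sg _; set v := `|w 2%N| `^ _.
have s0 : s != 0 by rewrite sgr_eq0.
have v0 : 0 < v by rewrite powR_gt0 // normr_gt0.
rewrite !powRN.
have a2 := powR_gt0 (p * u) L2; have ai := powR_gt0 (p * u) Li.
rewrite (_ : (L i.+2 / L 2%N) `^ (p * u) = L i.+2 `^ (p * u) / L 2%N `^ (p * u)); last first.
  rewrite powRM ?invr_ge0 ?(ltW Li) ?(ltW L2) //; congr (_ * _).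
  by rewrite -[(L 2%N)^-1]powR_inv1 ?(ltW L2) // -powRrM mulN1r powRN.
set x := (1 + _) `^ _; set a := L 2%N `^ _ in a2 *; set b := L i.+2 `^ _ in ai *.
move=> h.
have q0 : p * v * s != 0 by rewrite !mulf_neq0 // ?(gt_eqF v0) // gt_eqF //; lra.
apply: (mulfI q0).
transitivity (c i.+2 * (p * (v * x * s) / b) * (b / c 2%N)).
  by field; rewrite !gt_eqF.
by rewrite h; field; rewrite !gt_eqF.
Qed.


End real_inequalities.

(** * Comparing extended reals through their real upper bounds *)

Section ereal_bounds.
Local Open Scope ereal_scope.
Context {R : realType}.
Implicit Types (x y : \bar R) (k l c M : R).

Lemma lee_of_real_ubounds x y c : (0 < c)%R -> 0 <= y ->
  (forall l, (0 < l)%R -> y <= l%:E -> x <= (c * l)%:E) -> x <= c%:E * y.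
Proof.
move=> c0; case: y => [y|_ _|//]; last by rewrite gt0_muley ?lte_fin // leey.
rewrite lee_fin => y0 h; apply/lee_addgt0Pr => e e0.
have := h (y + e / c)%R; rewrite -EFinM -EFinD mulrDr mulrCA divff ?gt_eqF//.
rewrite mulr1; apply.
  by rewrite ltr_wpDl // divr_gt0.
by rewrite lee_fin lerDl divr_ge0 // ltW.
Qed.

Lemma eqe_of_real_ubounds x y : 0 <= x -> 0 <= y ->
  (forall l, (0 < l)%R -> (x <= l%:E) = (y <= l%:E)) -> x = y.
Proof.
move=> x0 y0 h; apply/eqP; rewrite eq_le -[y in x <= y]mul1e -[x in y <= x]mul1e.
by apply/andP; split; apply: lee_of_real_ubounds => // l l0;
  rewrite mul1r (h l l0).
Qed.

Lemma lee1_of_powR x M : (0 < M)%R ->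
  (forall k, (1 < k)%R -> x <= (k `^ M)%:E) -> x <= 1.
Proof.
move=> M0 h; apply/lee_addgt0Pr => e e0.
have := h ((1 + e) `^ M^-1)%R; rewrite -powRrM mulVf ?gt_eqF // powRr1; last first.
  by rewrite addr_ge0 // ltW.
by apply; rewrite powR_gt1 ?ltrDl ?invr_gt0.
Qed.

End ereal_bounds.

(** * The modular of one coordinate *)

Section exponent_density.
Local Open Scope ereal_scope.
Context d (T : measurableType d) (R : realType) (mu : {measure set T -> \bar R}).
Context (P U : T -> R) (M u0 : R).
Context (mP : measurable_fun [set: T] P) (mU : measurable_fun [set: T] U).
Context (HP : forall x, (1 < P x <= M)%R) (HU : forall x, (u0 <= U x < 1)%R).
Context (M_gt0 : (0 < M)%R) (u0_gt0 : (0 < u0)%R).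
Implicit Types (f g : T -> R) (k l c : R).

(** With U = 1/q, the integrand of the modular of f / l^(1/q). *)
Definition dens f l (x : T) : R := (`|f x| `^ P x * l `^ (- (P x * U x)))%R.

Definition Psi f l : \bar R := \int[mu]_x (dens f l x)%:E.

(** The term contributed by one coordinate to the modular of the mixed
    space; formally, the quasi-norm of |f|^q in the space of exponent p/q. *)
Definition phi f : \bar R := inf_pos (fun l => Psi f l <= 1).

Let P_gt0 x : (0 < P x)%R. Proof. by case/andP: (HP x) => P1 _; exact: lt_trans P1. Qed.
Let U_gt0 x : (0 < U x)%R. Proof. by case/andP: (HU x) => uU _; exact: lt_le_trans uU. Qed.
Let PU_ge x : (u0 <= P x * U x)%R.
Proof.
case/andP: (HP x) (HU x) => P1 _ /andP[uU _]; apply: (le_trans uU).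
by rewrite ler_peMl ?(ltW (U_gt0 x)) // ltW.
Qed.
Let PU_le x : (P x * U x <= M)%R.
Proof.
case/andP: (HP x) (HU x) => _ PM /andP[_ U1]; apply: le_trans PM.
by rewrite ler_piMr ?(ltW (P_gt0 x)) // ltW.
Qed.

Lemma measurable_powR_fun f (e : T -> R) : measurable_fun [set: T] f ->
  measurable_fun [set: T] e -> measurable_fun [set: T] (fun x => `|f x| `^ e x)%R.
Proof.
move=> mf me.
rewrite (_ : (fun x => _) = fun x => if (`|f x| == 0)%R
    then (if (e x == 0)%R then 1%R else 0%R) else expR (e x * ln `|f x|)); last first.
  by apply/funext => x; rewrite /powR; case: ifP => // _; case: ifP.
have mnf : measurable_fun [set: T] (fun x => `|f x|)%R by exact: measurableT_comp.
apply: measurable_fun_ifT; first exact: measurable_fun_eqr.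
  by apply: measurable_fun_ifT => //; exact: measurable_fun_eqr.
apply: measurableT_comp => //; apply: measurable_funM => //.
by apply: measurableT_comp mnf; exact: measurable_ln.
Qed.

Lemma measurable_powR_cst l (e : T -> R) : (0 < l)%R -> measurable_fun [set: T] e ->
  measurable_fun [set: T] (fun x => l `^ e x)%R.
Proof. by move=> l0 me; exact: (measurableT_comp (measurable_powRr l)). Qed.

Lemma measurable_dens f l : (0 < l)%R -> measurable_fun [set: T] f ->
  measurable_fun [set: T] (dens f l).
Proof.
move=> l0 mf; apply: measurable_funM.
  exact: measurable_powR_fun.
apply: measurable_powR_cst => //.
by apply: measurableT_comp => //; exact: measurable_funM.
Qed.

Lemma dens_ge0 f l x : (0 <= dens f l x)%R.
Proof. by rewrite mulr_ge0 ?powR_ge0. Qed.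

Lemma dens_mul f g l x : dens (fun x => g x * f x)%R l x = (`|g x| `^ P x * dens f l x)%R.
Proof. by rewrite /dens normrM powRM // mulrA. Qed.

Lemma dens_homo f k l x : (0 < k)%R -> (0 < l)%R ->
  dens f (k * l) x = (k `^ (- (P x * U x)) * dens f l x)%R.
Proof. by move=> k0 l0; rewrite /dens powRM ?ltW // mulrCA. Qed.

Lemma Psi_ge0 f l : 0 <= Psi f l.
Proof. by apply: integral_ge0 => x _; rewrite lee_fin dens_ge0. Qed.

Lemma le_Psi f g k l l' : measurable_fun [set: T] f -> measurable_fun [set: T] g ->
  (0 <= k)%R -> (0 < l)%R -> (0 < l')%R ->
  (forall x, dens f l x <= k * dens g l' x)%R -> Psi f l <= k%:E * Psi g l'.
Proof.
move=> mf mg k0 l0 l'0 fg; rewrite /Psi -ge0_integralZl_EFin //; first last.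
- by apply/measurable_EFinP; exact: measurable_dens.
- by move=> x _; rewrite lee_fin dens_ge0.
apply: ge0_le_integral => //.
- by move=> x _; rewrite lee_fin dens_ge0.
- by apply/measurable_EFinP; exact: measurable_dens.
- by apply/measurable_EFinP; apply: measurable_funM => //; exact: measurable_dens.
- by move=> x _; rewrite -EFinM lee_fin.
Qed.

Lemma measurable_shift f c : (0 < c)%R -> measurable_fun [set: T] f ->
  measurable_fun [set: T] (fun x => c `^ U x * f x)%R.
Proof. by move=> c0 mf; apply: measurable_funM => //; exact: measurable_powR_cst. Qed.

(** The map f |-> c^U f acts on the modular as a rescaling of l. *)
Lemma Psi_shift f c l : (0 < c)%R -> (0 < l)%R ->
  Psi (fun x => c `^ U x * f x)%R l = Psi f (c^-1 * l).
Proof.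
move=> c0 l0; apply: eq_integral => x _; rewrite dens_mul dens_homo ?invr_gt0 //.
rewrite ger0_norm ?powR_ge0 // -powRrM; congr (_ * _)%:E.
by rewrite powRN -[c^-1%R]powR_inv1 ?ltW // -powRrM mulN1r powRN invrK mulrC.
Qed.

Lemma Psi_grow f k l : (1 <= k)%R -> (0 < l)%R -> measurable_fun [set: T] f ->
  Psi f l <= (k `^ M)%:E * Psi f (k * l).
Proof.
move=> k1 l0 mf; have k0 : (0 < k)%R by lra.
apply: le_Psi => //; rewrite ?powR_ge0 ?mulr_gt0 // => x.
rewrite dens_homo // mulrA ler_peMl ?dens_ge0 //.
rewrite -powRD; last by rewrite (gt_eqF k0) implybT.
by rewrite -[leLHS](powRr0 k) ler_powR // subr_ge0.
Qed.

Lemma Psi_decay f k l : (1 <= k)%R -> (0 < l)%R -> measurable_fun [set: T] f ->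
  Psi f (k * l) <= (k `^ (- u0))%:E * Psi f l.
Proof.
move=> k1 l0 mf; have k0 : (0 < k)%R by lra.
apply: le_Psi => //; rewrite ?powR_ge0 ?mulr_gt0 // => x.
rewrite dens_homo // ler_wpM2r ?dens_ge0 //.
by rewrite ler_powR // lerN2.
Qed.

Lemma Psi_le f l l' : (0 < l)%R -> (l <= l')%R -> measurable_fun [set: T] f ->
  Psi f l' <= Psi f l.
Proof.
move=> l0 ll' mf; have k1 : (1 <= l' / l)%R by rewrite ler_pdivlMr // mul1r.
have -> : (l' = l' / l * l)%R by rewrite divfK // gt_eqF.
apply: (le_trans (Psi_decay k1 l0 mf)).
have k_le1 : ((l' / l) `^ (- u0))%:E <= 1.
  by rewrite lee_fin -[leRHS](powRr0 (l' / l)%R) ler_powR // oppr_le0 ltW.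
have := lee_wpmul2r (Psi_ge0 f l) k_le1.
by rewrite mul1e.
Qed.

Lemma Psi_scale f k s l : (0 <= s <= k)%R -> (1 <= k)%R -> (0 < l)%R ->
  measurable_fun [set: T] f ->
  Psi (fun x => s * f x)%R (k `^ u0^-1 * l) <= Psi f l.
Proof.
move=> /andP[s0 sk] k1 l0 mf; have k0 : (0 < k)%R by lra.
rewrite -[leRHS]mul1e; apply: le_Psi => //.
- exact: measurable_funM.
- by rewrite mulr_gt0 ?powR_gt0.
move=> x; rewrite dens_mul dens_homo ?powR_gt0 // mulrA ler_wpM2r ?dens_ge0 //.
apply: (@le_trans _ _ (k `^ P x * (k `^ u0^-1) `^ (- (P x * U x)))%R).
  rewrite ler_wpM2r ?powR_ge0 // ger0_norm //.
  by apply: ge0_ler_powR; rewrite ?nnegrE // ltW.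
rewrite -powRrM -powRD; last by rewrite (gt_eqF k0) implybT.
rewrite -[leRHS](powRr0 k) ler_powR //.
rewrite mulrN subr_le0 mulrCA ler_peMr ?(ltW (P_gt0 _)) //.
by rewrite mulrC ler_pdivlMr // mul1r; case/andP: (HU x).
Qed.

Lemma phi_ge0 f : 0 <= phi f.
Proof. by apply: le_ereal_inf_tmp => _ [l [l0 _] <-]; rewrite lee_fin ltW. Qed.

(** A positive infimum is attained, since Psi f is continuous in l:
    multiplying l by k close to 1 changes Psi f by a factor close to 1. *)
Lemma phi_leE f l : (0 < l)%R -> measurable_fun [set: T] f ->
  (phi f <= l%:E) = (Psi f l <= 1).
Proof.
move=> l0 mf; apply/idP/idP => [fl|fl]; last first.
  by apply: ereal_inf_lbound; exists l.
apply: (@lee1_of_powR _ _ M) => // k k1.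
have : phi f < (k * l)%:E by apply: (le_lt_trans fl); rewrite lte_fin ltr_pMl.
move=> /ereal_inf_lt[_ [l' [l'0 fl'] <-]]; rewrite lte_fin => l'kl.
have fkl : Psi f (k * l) <= 1 := le_trans (Psi_le l'0 (ltW l'kl) mf) fl'.
have kM0 : 0 <= (k `^ M)%:E by rewrite lee_fin powR_ge0.
have := lee_wpmul2l kM0 fkl; rewrite mule1.
exact: le_trans (Psi_grow (ltW k1) l0 mf).
Qed.

Lemma phi_le f l : (0 < l)%R -> Psi f l <= 1 -> phi f <= l%:E.
Proof. by move=> l0 fl; apply: ereal_inf_lbound; exists l. Qed.

Lemma Psi_le1 f l : (0 < l)%R -> measurable_fun [set: T] f ->
  phi f <= l%:E -> Psi f l <= 1.
Proof. by move=> l0 mf; rewrite (phi_leE l0 mf). Qed.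

Lemma phi_lt f l : (0 < l)%R -> measurable_fun [set: T] f ->
  Psi f l < 1 -> phi f < l%:E.
Proof.
move=> l0 mf fl.
have fin : Psi f l \is a fin_num.
  by rewrite ge0_fin_numE ?Psi_ge0 // (lt_trans fl) // ltry.
have r0 : (0 <= fine (Psi f l))%R by rewrite fine_ge0 ?Psi_ge0.
set r := fine (Psi f l) in r0.
have r1 : (r < 1)%R by rewrite -lte_fin fineK.
(* Lowering l by a factor k multiplies Psi f l by at most k ^ M = 1 / r'. *)
pose r' := ((r + 1) / 2)%R.
have r'0 : (0 < r')%R by rewrite /r'; lra.
have r'1 : (r' < 1)%R by rewrite /r'; lra.
have rr' : (r <= r')%R by rewrite /r'; lra.
pose k := (r'^-1 `^ M^-1)%R.
have k1 : (1 < k)%R.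
  by rewrite powR_gt1 ?invr_gt0 ?invf_gt1.
have kM : (k `^ M = r'^-1)%R.
  by rewrite /k -powRrM mulVf ?gt_eqF // powRr1 // invr_ge0 ltW.
have k0 : (0 < k)%R by lra.
have kl0 : (0 < k^-1 * l)%R by rewrite mulr_gt0 ?invr_gt0.
apply: (@le_lt_trans _ _ (k^-1 * l)%:E); last first.
  by rewrite lte_fin gtr_pMl // invf_lt1.
apply: (phi_le kl0); apply: (le_trans (Psi_grow (ltW k1) kl0 mf)).
rewrite mulVKf ?gt_eqF // kM -(fineK fin) -EFinM lee_fin.
by rewrite ler_pdivrMl // mulr1.
Qed.

Lemma phi_eq_Psi f l : (0 < l)%R -> measurable_fun [set: T] f ->
  phi f = l%:E -> Psi f l = 1.
Proof.
move=> l0 mf fl; apply/eqP; rewrite eq_le -phi_leE // fl lexx /= leNgt.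
by apply/negP => /(phi_lt l0 mf); rewrite fl ltxx.
Qed.

(** Homogeneity of phi along the linear maps f |-> c^U f. Linearity is
    what allows convexity inequalities to be rescaled. *)
Lemma phi_shift f c : (0 < c)%R -> measurable_fun [set: T] f ->
  phi (fun x => c `^ U x * f x)%R = c%:E * phi f.
Proof.
move=> c0 mf; apply: eqe_of_real_ubounds => [||l l0].
- exact: phi_ge0.
- by rewrite mule_ge0 ?phi_ge0 // lee_fin ltW.
rewrite phi_leE //; last exact: measurable_shift.
rewrite Psi_shift // -phi_leE ?mulr_gt0 ?invr_gt0 //.
by rewrite EFinM lee_pdivlMl.
Qed.

(** Multiplication by a scalar is not a shift, but s <= k <= (k^(1/u0))^U
    bounds it by one. *)
Lemma phi_scale f k s : (0 <= s <= k)%R -> (1 <= k)%R -> measurable_fun [set: T] f ->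
  phi (fun x => s * f x)%R <= (k `^ u0^-1)%:E * phi f.
Proof.
move=> sk k1 mf; have k0 : (0 < k)%R by lra.
apply: lee_of_real_ubounds => [||l l0]; rewrite ?powR_gt0 ?phi_ge0 //.
have kl0 : (0 < k `^ u0^-1 * l)%R by rewrite mulr_gt0 ?powR_gt0.
move=> /(Psi_le1 l0 mf) h; apply: (phi_le kl0).
exact: le_trans (Psi_scale sk k1 l0 mf) h.
Qed.

(** If phi f = 0, then Psi f l <= 1 for all l > 0, while Psi f 1 is smaller
    than Psi f l by a factor that tends to 0 with l. *)
Lemma phi_eq0 f : measurable_fun [set: T] f -> phi f = 0 ->
  ae_eq mu [set: T] f (cst 0%R).
Proof.
move=> mf f0.
have Psi0 : Psi f 1 = 0.
  apply/eqP; rewrite eq_le Psi_ge0 andbT; apply/lee_addgt0Pr => e e0.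
  rewrite add0e.
  pose s := Num.max 1%R (e^-1)%R; have s1 : (1 <= s)%R by rewrite le_max lexx.
  have s0 : (0 < s)%R by lra.
  pose k := (s `^ u0^-1)%R.
  have k1 : (1 <= k)%R.
    by rewrite -[leLHS](powRr0 s) ler_powR // invr_ge0 ltW.
  have k0 : (0 < k)%R by lra.
  have k'0 : (0 < k^-1)%R by rewrite invr_gt0.
  rewrite (_ : 1%R = (k * k^-1)%R); last by rewrite divff ?gt_eqF.
  apply: (le_trans (Psi_decay k1 k'0 mf)).
  apply: (@le_trans _ _ ((k `^ (- u0))%:E * 1)).
    rewrite lee_wpmul2l ?lee_fin ?powR_ge0 // -phi_leE // f0 lee_fin.
    exact: ltW.
  rewrite mule1 lee_fin /k powRN -powRrM mulVf ?gt_eqF // powRr1 ?(ltW s0) //.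
  by rewrite -[leRHS]invrK lef_pV2 ?posrE ?invr_gt0 // le_max lexx orbT.
have md : measurable_fun [set: T] (fun x => (dens f 1 x)%:E).
  by apply/measurable_EFinP; apply: measurable_dens.
have /ae_eq_integral_abs : \int[mu]_x `|(dens f 1 x)%:E| = 0.
  rewrite -[RHS]Psi0; apply: eq_integral => x _.
  by rewrite gee0_abs // lee_fin dens_ge0.
move=> /(_ measurableT md); apply: filterS => x /(_ I) [/eqP].
rewrite /dens powR1 mulr1 powR_eq0 normr_eq0 => /andP[/eqP -> _] _ //.
Qed.

(** * The gradient of phi *)

Local Close Scope ereal_scope.

Lemma measurable_sg f : measurable_fun [set: T] f ->
  measurable_fun [set: T] (fun x => Num.sg (f x)).
Proof.
move=> mf; rewrite (_ : (fun x => _) =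
    fun x => if f x == 0 then 0 else if f x < 0 then -1 else 1); last first.
  by apply/funext => x; rewrite /Num.sg; case: ifP => // _; case: ifP.
apply: measurable_fun_ifT => //; first exact: measurable_fun_eqr.
by apply: measurable_fun_ifT => //; exact: measurable_fun_ltr.
Qed.

Lemma measurable_invr_fun f : measurable_fun [set: T] f ->
  measurable_fun [set: T] (fun x => (f x)^-1).
Proof.
move=> mf; rewrite (_ : (fun x => _) = fun x => Num.sg (f x) * `|f x| `^ (-1)).
  apply: measurable_funM; first exact: measurable_sg.
  exact: measurable_powR_fun.
apply/funext => x; rewrite powR_inv1 // [in LHS](numEsg (f x)) invfM.
congr (_ * _); case: sgrP => //; rewrite ?invr0 ?invr1 ?invrN1 //.
Qed.

Lemma integral_EFin (h : T -> R) : mu.-integrable [set: T] (EFin \o h) ->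
  (\int[mu]_x (h x)%:E = (\int[mu]_x h x)%:E)%E.
Proof. by move=> ih; rewrite /Rintegral fineK //; exact: integrable_fin_num. Qed.

Lemma integrable_scale (h : T -> R) k : mu.-integrable [set: T] (EFin \o h) ->
  mu.-integrable [set: T] (EFin \o (fun x => k * h x)).
Proof. by move=> ih; exact: (integrableZl measurableT k ih). Qed.

Lemma integrable_dens_mul f l (h : T -> R) K : 0 < l -> measurable_fun [set: T] f ->
  (Psi f l < +oo)%E -> measurable_fun [set: T] h -> (forall x, `|h x| <= K) ->
  mu.-integrable [set: T] (EFin \o (fun x => dens f l x * h x)).
Proof.
move=> l0 mf foo mh hK.
have md : measurable_fun [set: T] (fun x => (dens f l x)%:E).
  by apply/measurable_EFinP; exact: measurable_dens.
have id : mu.-integrable [set: T] (fun x => (dens f l x)%:E).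
  apply/integrableP; split => //.
  rewrite (_ : (\int[mu]_x _)%E = Psi f l) //.
  by apply: eq_integral => x _; rewrite gee0_abs // lee_fin dens_ge0.
apply: (le_integrable measurableT _ _ (integrableZl measurableT K id)).
  by apply/measurable_EFinP; apply: measurable_funM => //; exact: measurable_dens.
move=> x _ /=; rewrite lee_fin !normrM mulrC ler_wpM2r //.
exact: le_trans (hK x) (ler_norm _).
Qed.

Lemma Rintegral_dens f l : Psi f l = 1%E -> \int[mu]_x dens f l x = 1.
Proof. by rewrite /Psi /Rintegral => ->. Qed.

(** One half of the differentiability of phi: a perturbation (f, l) |->
    ((1 + eps e) f, l + eps a) along which the integral of the density has
    negative derivative makes that integral smaller than 1, so that phi stays
    below l + eps a. *)
Lemma phi_perturb f l (e : T -> R) a : 0 < l -> measurable_fun [set: T] f ->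
  measurable_fun [set: T] e -> (forall x, `|e x| <= 1) -> phi f = l%:E ->
  \int[mu]_x (dens f l x * (P x * (e x - U x * (a / l)))) < 0 ->
  exists2 eps0, 0 < eps0 & forall eps, 0 < eps < eps0 ->
    (phi (fun x => (1 + eps * e x) * f x)%R < (l + eps * a)%:E)%E.
Proof.
move=> l0 mf me e1 fl; set b := a / l; set I := (X in X < 0) => I0.
have f1 := phi_eq_Psi l0 mf fl.
have foo : (Psi f l < +oo)%E by rewrite f1 ltry.
(* When T is empty the integral is 0; otherwise 1 <= M. *)
have [xT|M1] := pselect (exists x : T, True); last first.
  exfalso; move: I0; rewrite /I /Rintegral [X in fine X](_ : _ = 0%E) ?ltxx //.
  by apply: integral0_eq => x _; case: M1; exists x.
have {xT}M1 : 1 <= M by case: xT => x _; have := HP x; lra.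
pose B := M * (1 + `|b| + 2 * b ^+ 2); pose K := 2 * M * b ^+ 2 + 2 * B ^+ 2.
have b0 := normr_ge0 b; have b20 := sqr_ge0 b.
have B1 : 1 <= B by rewrite /B; nra.
have Bb : `|b| <= B by rewrite /B; nra.
have K0 : 0 < K by rewrite /K; nra.
exists (Num.min (2 * B)^-1 (- I / K)).
  rewrite lt_min invr_gt0 mulr_gt0 //=; last lra.
  by rewrite divr_gt0 // oppr_gt0.
move=> eps /andP[eps0]; rewrite lt_min => /andP[epsB epsK].
have {}epsB : eps * B <= 2^-1.
  by rewrite -ler_pdivlMr -?invfM ?ltW //; lra.
have {}epsK : eps * K < - I by rewrite -ltr_pdivlMr.
have eb : 0 < 1 + eps * b.
  by move: Bb; rewrite ler_norml => /andP[]; nra.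
have -> : l + eps * a = (1 + eps * b) * l by rewrite /b; field; rewrite gt_eqF.
have mpert : measurable_fun [set: T] (fun x => (1 + eps * e x) * f x).
  apply: measurable_funM => //; apply: measurable_funD => //.
  exact: measurable_funM.
apply: phi_lt => //; first exact: mulr_gt0.
pose L x := P x * (e x - U x * b).
have mL : measurable_fun [set: T] L.
  apply: measurable_funM => //; apply: measurable_funB => //.
  exact: measurable_funM.
have LK x : `|L x| <= M * (1 + `|b|).
  rewrite /L normrM; apply: ler_pM => //.
    by rewrite gtr0_norm //; case/andP: (HP x).
  apply: (le_trans (ler_normB _ _)); apply: lerD => //.
  rewrite normrM (gtr0_norm (U_gt0 x)) ler_piMl //.
  by case/andP: (HU x) => _ /ltW.
have i1 : mu.-integrable [set: T] (EFin \o (fun x => dens f l x * 1)).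
  by apply: (@integrable_dens_mul _ _ _ 1) => // x; rewrite normr1.
have i2 := integrable_dens_mul l0 mf foo mL LK.
pose G x := (1 + eps ^+ 2 * K) * (dens f l x * 1) + eps * (dens f l x * L x).
have iG1 : mu.-integrable [set: T]
    (EFin \o (fun x => (1 + eps ^+ 2 * K) * (dens f l x * 1))).
  exact: integrable_scale.
have iG2 : mu.-integrable [set: T] (EFin \o (fun x => eps * (dens f l x * L x))).
  exact: integrable_scale.
have iG : mu.-integrable [set: T] (EFin \o G).
  exact: (integrableD measurableT iG1 iG2).
apply: (@le_lt_trans _ _ (\int[mu]_x (G x)%:E)%E).
  apply: ge0_le_integral => //.
  - by move=> x _; rewrite lee_fin dens_ge0.
  - by apply/measurable_EFinP; apply: measurable_dens => //; exact: mulr_gt0.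
  - exact: measurable_int iG.
  move=> x _; rewrite lee_fin dens_mul dens_homo //.
  have -> : `|1 + eps * e x| = 1 + eps * e x.
    have := e1 x; rewrite ler_norml => /andP[? ?].
    by rewrite ger0_norm //; nra.
  have -> : G x = dens f l x * (1 + eps ^+ 2 * K + eps * L x) by rewrite /G; ring.
  rewrite mulrA mulrC.
  rewrite ler_wpM2l ?dens_ge0 //.
  have h : (1 + eps * e x) `^ P x * (1 + eps * b) `^ (- (P x * U x)) <=
      1 + eps * (P x * (e x - U x * b)) + eps ^+ 2 * K.
    apply: perturbation_bound => //.
      by rewrite ltW //; case/andP: (HP x).
    by rewrite ltW //; case/andP: (HU x) => _ /ltW.
  by apply: (le_trans h); rewrite /L; lra.
rewrite integral_EFin // lte_fin RintegralD // !RintegralZl //.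
rewrite [X in _ * X + _](_ : _ = 1); last first.
  rewrite -[RHS](Rintegral_dens f1); apply: eq_Rintegral => x _.
  by rewrite mulr1.
have -> : \int[mu]_x (dens f l x * L x) = I by [].
nra.
Qed.

(** The gradient in f of the integral of [dens f l]. *)
Definition grad f l x := P x * (`|f x| `^ (P x - 1) * Num.sg (f x)) * l `^ (- (P x * U x)).

(** Minus l times the derivative in l of the integral of [dens f l]: the
    implicit function theorem gives [l / slope f l * grad f l] as the gradient
    of phi at f when l = phi f. *)
Definition slope f l := \int[mu]_x (dens f l x * (P x * U x)).

Lemma measurable_grad f l : 0 < l -> measurable_fun [set: T] f ->
  measurable_fun [set: T] (grad f l).
Proof.
move=> l0 mf; apply: measurable_funM; last first.
  apply: measurable_powR_cst => //.
  by apply: measurableT_comp => //; exact: measurable_funM.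
apply: measurable_funM => //; apply: measurable_funM; last exact: measurable_sg.
by apply: measurable_powR_fun => //; exact: measurable_funB.
Qed.

Lemma grad_mul f l x : grad f l x * f x = dens f l x * P x.
Proof.
rewrite /grad /dens; have [->|f0] := eqVneq (f x) 0.
  by rewrite mulr0 normr0 powR0 ?mul0r // gt_eqF.
have nf0 : `|f x| != 0 by rewrite normr_eq0.
rewrite (_ : `|f x| `^ P x = `|f x| `^ (P x - 1) * (Num.sg (f x) * f x)); last first.
  by rewrite -normrEsg -[X in _ * X]powRr1 // -powRD ?nf0 ?implybT // subrK.
ring.
Qed.

Lemma slope_gt0 f l : 0 < l -> measurable_fun [set: T] f -> Psi f l = 1%E ->
  0 < slope f l.
Proof.
move=> l0 mf f1; have foo : (Psi f l < +oo)%E by rewrite f1 ltry.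
apply: (@lt_le_trans _ _ (\int[mu]_x (dens f l x * u0))).
  rewrite RintegralZr //; first by rewrite Rintegral_dens // mul1r.
  have := @integrable_dens_mul f l (cst 1) 1 l0 mf foo.
  rewrite (_ : EFin \o (fun x => _ * _) = EFin \o dens f l).
    by apply => // x; rewrite normr1.
  by apply/funext => x /=; rewrite mulr1.
apply: le_Rintegral => //.
- by apply: (@integrable_dens_mul _ _ _ `|u0|).
- apply: (@integrable_dens_mul _ _ _ M) => //; first exact: measurable_funM.
  by move=> x; rewrite gtr0_norm // mulr_gt0.
- by move=> x _; rewrite ler_wpM2l ?dens_ge0.
Qed.

Lemma integral_perturb f l (e : T -> R) a : 0 < l -> measurable_fun [set: T] f ->
  measurable_fun [set: T] e -> (forall x, `|e x| <= 1) -> Psi f l = 1%E ->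
  \int[mu]_x (dens f l x * (P x * (e x - U x * (a / l)))) =
  \int[mu]_x (dens f l x * (P x * e x)) - a / l * slope f l.
Proof.
move=> l0 mf me e1 f1; have foo : (Psi f l < +oo)%E by rewrite f1 ltry.
have i1 : mu.-integrable [set: T] (EFin \o (fun x => dens f l x * (P x * e x))).
  apply: (@integrable_dens_mul _ _ _ M) => //; first exact: measurable_funM.
  move=> x; rewrite normrM -[M]mulr1; apply: ler_pM => //.
  by rewrite gtr0_norm //; case/andP: (HP x).
have i2 : mu.-integrable [set: T] (EFin \o (fun x => dens f l x * (P x * U x))).
  apply: (@integrable_dens_mul _ _ _ M) => //; first exact: measurable_funM.
  by move=> x; rewrite gtr0_norm // mulr_gt0.
rewrite /slope -RintegralZl // -RintegralB //; last exact: integrable_scale.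
by apply: eq_Rintegral => x _; ring.
Qed.

(** A convex function phi with equality at the midpoint of f and g satisfies
    phi (f + h) + phi (g - h) >= phi f + phi g for all h, so that its
    derivatives at f and g agree. The test direction h is minus the sign of the
    difference D of the gradients, times min (|f|, |g|); this weight makes
    h / f and h / g bounded. *)
Lemma grad_proportional f g (lf lg : R) : 0 < lf -> 0 < lg ->
  measurable_fun [set: T] f -> measurable_fun [set: T] g ->
  phi f = lf%:E -> phi g = lg%:E ->
  (forall h : T -> R, measurable_fun [set: T] h ->
     (forall x, `|h x| <= `|f x| /\ `|h x| <= `|g x|) ->
     ((lf + lg)%:E <= phi (fun x => f x + h x)%R + phi (fun x => g x - h x)%R)%E) ->
  {ae mu, forall x, f x != 0 -> g x != 0 ->
    lf / slope f lf * grad f lf x = lg / slope g lg * grad g lg x}.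
Proof.
move=> lf0 lg0 mf mg fl gl opt.
have f1 := phi_eq_Psi lf0 mf fl; have g1 := phi_eq_Psi lg0 mg gl.
have Nf0 := slope_gt0 lf0 mf f1; have Ng0 := slope_gt0 lg0 mg g1.
have foo : (Psi f lf < +oo)%E by rewrite f1 ltry.
have goo : (Psi g lg < +oo)%E by rewrite g1 ltry.
have [cf cfE] : exists cf, cf = lf / slope f lf := ex_intro _ _ erefl.
have [cg cgE] : exists cg, cg = lg / slope g lg := ex_intro _ _ erefl.
rewrite -cfE -cgE.
pose D x := cf * grad f lf x - cg * grad g lg x.
pose m (x : T) : R := Num.min `|f x| `|g x|.
pose h x := - (Num.sg (D x) * m x).
have mD : measurable_fun [set: T] D.
  by apply: measurable_funB; apply: measurable_funM => //; exact: measurable_grad.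
have mm : measurable_fun [set: T] m.
  by apply: measurable_minr; exact: measurableT_comp.
have mh : measurable_fun [set: T] h.
  apply: measurableT_comp => //; apply: measurable_funM => //.
  exact: measurable_sg.
have m0 x : 0 <= m x by rewrite le_min !normr_ge0.
have hm x : `|h x| <= m x.
  rewrite /h normrN normrM (ger0_norm (m0 x)) ler_piMl //.
  by rewrite normr_sg; case: (D x != 0).
have hf x : `|h x| <= `|f x| by apply: (le_trans (hm x)); rewrite ge_min lexx.
have hg x : `|h x| <= `|g x| by apply: (le_trans (hm x)); rewrite ge_min lexx orbT.
(* Where u vanishes, so does h, and h / u is 0. *)
have quot (u : T -> R) : measurable_fun [set: T] u -> (forall x, `|h x| <= `|u x|) ->
    [/\ measurable_fun [set: T] (fun x => h x / u x),
        (forall x, `|h x / u x| <= 1) & forall x, h x / u x * u x = h x].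
  move=> mu_ hu; split => [|x|x].
  - by apply: measurable_funM => //; exact: measurable_invr_fun.
  - have [->|u0'] := eqVneq (u x) 0; first by rewrite invr0 mulr0 normr0.
    by rewrite normrM normfV ler_pdivrMr ?normr_gt0 // mul1r.
  - have [ux0|u0'] := eqVneq (u x) 0; last by rewrite divfK.
    by have := hu x; rewrite ux0 normr0 normr_le0 mulr0 => /eqP.
have [mef ef1 efE] := quot f mf hf; have [meg eg1 egE] := quot g mg hg.
set ef := (fun x => h x / f x : R) in mef ef1 efE.
set eg := (fun x => h x / g x : R) in meg eg1 egE.
have meg' : measurable_fun [set: T] (fun x => - eg x) by exact: measurableT_comp.
have eg1' x : `|- eg x| <= 1 by rewrite normrN eg1.
have bnd (e : T -> R) x : (forall x, `|e x| <= 1) -> `|P x * e x| <= M.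
  move=> e1; rewrite normrM -[M]mulr1; apply: ler_pM => //.
  by rewrite gtr0_norm //; case/andP: (HP x).
have iF : mu.-integrable [set: T] (EFin \o (fun x => dens f lf x * (P x * ef x))).
  apply: (@integrable_dens_mul _ _ _ M) => //; first exact: measurable_funM.
  by move=> x; exact: bnd.
have iG : mu.-integrable [set: T] (EFin \o (fun x => dens g lg x * (P x * eg x))).
  apply: (@integrable_dens_mul _ _ _ M) => //; first exact: measurable_funM.
  by move=> x; exact: bnd.
have [F FE] : exists F, F = \int[mu]_x (dens f lf x * (P x * ef x))
  := ex_intro _ _ erefl.
have [G GE] : exists G, G = \int[mu]_x (dens g lg x * (P x * eg x))
  := ex_intro _ _ erefl.
have iG' := integrable_scale cg iG; have iF' := integrable_scale cf iF.
have DmE x : cg * (dens g lg x * (P x * eg x)) - cf * (dens f lf x * (P x * ef x)) =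
    `|D x| * m x.
  have Fh : dens f lf x * (P x * ef x) = grad f lf x * h x.
    by rewrite mulrA -grad_mul -mulrA [f x * _]mulrC efE.
  have Gh : dens g lg x * (P x * eg x) = grad g lg x * h x.
    by rewrite mulrA -grad_mul -mulrA [g x * _]mulrC egE.
  transitivity (- D x * h x); first by rewrite Fh Gh /D; ring.
  by rewrite normrEsg /h mulrNN mulrA (mulrC (D x)).
have iDm : mu.-integrable [set: T] (EFin \o (fun x => `|D x| * m x)).
  have := integrableB measurableT iG' iF'; congr (mu.-integrable _ _).
  by apply/funext => x; rewrite /= -EFinB DmE.
have intDm : \int[mu]_x (`|D x| * m x) = cg * G - cf * F.
  rewrite FE GE -(RintegralZl cg measurableT iG) -(RintegralZl cf measurableT iF).
  rewrite -(RintegralB measurableT iG' iF').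
  by apply: eq_Rintegral => x _; rewrite DmE.
have cf0 : 0 < cf by rewrite cfE; exact: divr_gt0 lf0 Nf0.
have cg0 : 0 < cg by rewrite cgE; exact: divr_gt0 lg0 Ng0.
have Dm0 : \int[mu]_x (`|D x| * m x) = 0.
  apply/eqP; rewrite eq_le andbC Rintegral_ge0 /=; last first.
    by move=> x _; rewrite mulr_ge0.
  rewrite leNgt; apply/negP; rewrite intDm subr_gt0 => FG.
  have [a /andP[aF aG]] : exists a, cf * F < a < cg * G.
    by exists ((cf * F + cg * G) / 2); rewrite !midf_lt.
  have [|e1 e10 ph1] := @phi_perturb f lf ef a lf0 mf mef ef1 fl.
    rewrite integral_perturb // -FE subr_lt0.
    rewrite (_ : a / lf * slope f lf = cf^-1 * a); last first.
      by rewrite cfE invf_div mulrC mulrA mulrAC.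
    by rewrite ltr_pdivlMl.
  have [|e2 e20 ph2] := @phi_perturb g lg (fun x => - eg x) (- a) lg0 mg meg' eg1' gl.
    rewrite integral_perturb //.
    rewrite (_ : - a / lg * slope g lg = - (cg^-1 * a)); last first.
      by rewrite cgE invf_div mulrC mulrA mulrAC !mulrN.
    rewrite (_ : \int[mu]_x _ = -1 * G); last first.
      by rewrite GE -(RintegralZl (-1) measurableT iG); apply: eq_Rintegral => x _; ring.
    by rewrite opprK mulN1r addrC subr_lt0 ltr_pdivrMl.
  have [eps eps0 [epsl1 epse1 epse2]] : exists2 eps, 0 < eps &
      [/\ eps < 1, eps < e1 & eps < e2].
    have mn0 : 0 < Num.min 1 (Num.min e1 e2) by rewrite !lt_min ltr01 e10.
    exists (Num.min 1 (Num.min e1 e2) / 2); first by rewrite divr_gt0.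
    have : Num.min 1 (Num.min e1 e2) / 2 < Num.min 1 (Num.min e1 e2).
      by rewrite gtr_pMr // invf_lt1 // ltr1n.
    by rewrite !lt_min => /and3P[].
  have p1 := ph1 eps; have p2 := ph2 eps.
  rewrite eps0 epse1 in p1; rewrite eps0 epse2 in p2.
  have := opt (fun x => eps * h x); rewrite leNgt => /(_ _ _)/negP; apply.
  - exact: measurable_funM.
  - move=> x; rewrite normrM (gtr0_norm eps0); split.
      by apply: le_trans (hf x); rewrite ler_piMl // ltW.
    by apply: le_trans (hg x); rewrite ler_piMl // ltW.
  rewrite (_ : lf + lg = (lf + eps * a) + (lg + eps * - a)); last by ring.
  rewrite EFinD; apply: lteD.
    rewrite (_ : (fun x => _) = fun x => (1 + eps * ef x) * f x); first exact: p1.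
    by apply/funext => x; rewrite -[in LHS](efE x) /ef; ring.
  rewrite (_ : (fun x => _) = fun x => (1 + eps * - eg x) * g x); first exact: p2.
  by apply/funext => x; rewrite -[in LHS](egE x) /eg; ring.
have mDm : measurable_fun [set: T] (fun x => (`|D x| * m x)%:E).
  exact: measurable_int iDm.
have /(ae_eq_integral_abs _ measurableT mDm) :
    (\int[mu]_x `|(`|D x| * m x)%:E| = 0)%E.
  transitivity (\int[mu]_x (`|D x| * m x)%:E)%E.
    by apply: eq_integral => x _; rewrite gee0_abs // lee_fin mulr_ge0.
  by rewrite integral_EFin // Dm0.
apply: filterS => x /(_ I) [/eqP]; rewrite mulf_eq0 normr_eq0 => /orP[/eqP Dx|mx] fx gx.
  by apply/eqP; rewrite -subr_eq0; exact/eqP.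
move: mx; rewrite gt_eqF // lt_min !normr_gt0 fx gx //.
Qed.

(** * Segments along which phi is affine *)
Lemma ae_linear_relation (h1 h2 h3 : T -> R) (a1 a2 a3 : R) :
  mu.-integrable [set: T] (EFin \o h1) -> mu.-integrable [set: T] (EFin \o h2) ->
  mu.-integrable [set: T] (EFin \o h3) ->
  \int[mu]_x h1 x = 1 -> \int[mu]_x h2 x = 1 -> \int[mu]_x h3 x = 1 ->
  {ae mu, forall x, a1 * h1 x + a2 * h2 x + a3 * h3 x = 0} -> a1 + a2 + a3 = 0.
Proof.
move=> i1 i2 i3 e1 e2 e3 ae0.
have j1 := integrable_scale a1 i1; have j2 := integrable_scale a2 i2.
have j3 := integrable_scale a3 i3.
have j12 : mu.-integrable [set: T] (EFin \o (fun x => a1 * h1 x + a2 * h2 x)).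
  exact: (integrableD measurableT j1 j2).
have j123 : mu.-integrable [set: T]
    (EFin \o (fun x => a1 * h1 x + a2 * h2 x + a3 * h3 x)).
  exact: (integrableD measurableT j12 j3).
transitivity (\int[mu]_x (a1 * h1 x + a2 * h2 x + a3 * h3 x)).
  rewrite (RintegralD measurableT j12 j3) (RintegralD measurableT j1 j2).
  rewrite (RintegralZl a1 measurableT i1) (RintegralZl a2 measurableT i2).
  by rewrite (RintegralZl a3 measurableT i3) e1 e2 e3 !mulr1.
rewrite -[RHS]/(fine 0%E) -(integral0 mu [set: T]) /Rintegral; congr fine.
apply: ae_eq_integral => //; first exact: measurable_int j123.
by apply: filterS ae0 => x -> _.
Qed.

(** The strictness of the convexity of phi. The times k/8 for 0 < k < 8 are
    interior to the segment, and time 2/8 serves as the base point. The ratio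
    [Gam i] of the normalisations of the gradients at times (i+2)/8 and 2/8
    is the average of the pointwise ratio 1 + rho i of the functions. *)
Lemma phi_affine_rigid f g (Lam : R -> R) :
  measurable_fun [set: T] f -> measurable_fun [set: T] g ->
  (forall a b : T -> R, measurable_fun [set: T] a -> measurable_fun [set: T] b ->
    (2%:E * phi (fun x => 2^-1 * (a x + b x))%R <= phi a + phi b)%E) ->
  let W t x := f x + t * (g x - f x) in
  (forall t : R, 0 <= t <= 1 -> phi (W t) = (Lam t)%:E) ->
  (forall s t : R, 0 <= s <= 1 -> 0 <= t <= 1 ->
     Lam s + Lam t = 2 * Lam (2^-1 * (s + t))) ->
  ae_eq mu [set: T] f g.
Proof.
move=> mf mg conv W WL mid.
have mW t : measurable_fun [set: T] (W t).
  by apply: measurable_funD => //; apply: measurable_funM => //; exact: measurable_funB.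
have Lam_ge0 (t : R) : 0 <= t <= 1 -> 0 <= Lam t.
  by move=> t01; rewrite -lee_fin -(WL t t01); exact: phi_ge0.
have grid (k : nat) : (k <= 8)%N -> 0 <= (k%:R / 8 : R) <= 1.
  by move=> k8; rewrite divr_ge0 //= ler_pdivrMr // mul1r ler_nat.
have zero (t : R) : 0 <= t <= 1 -> Lam t = 0 -> {ae mu, forall x, W t x = 0}.
  move=> t01 Lt; have := phi_eq0 (mW t); rewrite WL // Lt => /(_ erefl).
  by apply: filterS => x /(_ I).
(* A nonnegative affine function with an interior zero is zero; then W
   vanishes almost everywhere at two different times. *)
have [Lam_gt0|] := pselect (forall k : nat, (0 < k < 8)%N -> 0 < Lam (k%:R / 8)); last first.
  move=> /existsNP[[|k] /not_implyP[// k8]].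
  have k1 := grid k.+1 (ltnW k8).
  move=> /negP; rewrite -leNgt => Lk.
  have k0 := grid k (leq_trans (leqnSn _) (ltnW k8)); have k2 := grid k.+2 k8.
  have L0 := Lam_ge0 _ k0; have L1 := Lam_ge0 _ k1; have L2 := Lam_ge0 _ k2.
  have := mid _ _ k0 k2.
  rewrite (_ : 2^-1 * _ = k.+1%:R / 8); last by rewrite -!natr1; field.
  move=> midE.
  have z0 : Lam (k%:R / 8) = 0 by lra.
  have z2 : Lam (k.+2%:R / 8) = 0 by lra.
  have := zero _ k2 z2; have := zero _ k0 z0; rewrite /W.
  apply: filterS2 => x h0 h2 _.
  have : g x - f x = 4 * ((f x + k.+2%:R / 8 * (g x - f x)) -
      (f x + k%:R / 8 * (g x - f x))) by rewrite -!natr1; field.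
  by rewrite h0 h2 subrr mulr0 => /eqP; rewrite subr_eq0 => /eqP.
pose L (k : nat) := Lam (k%:R / 8).
pose w (k : nat) x := W (k%:R / 8) x.
pose c (k : nat) := L k / slope (w k) (L k).
have wL (k : nat) : (0 < k < 8)%N -> phi (w k) = (L k)%:E.
  by move=> /andP[_ k8]; rewrite /w /L WL //; apply: grid; exact: ltnW.
have mw (k : nat) : measurable_fun [set: T] (w k) by exact: mW.
have w1 (k : nat) : (0 < k < 8)%N -> Psi (w k) (L k) = 1%E.
  by move=> k8; apply: phi_eq_Psi => //; [exact: Lam_gt0|exact: wL].
have c_gt0 (k : nat) : (0 < k < 8)%N -> 0 < c k.
  move=> k8; apply: divr_gt0; first exact: Lam_gt0.
  by apply: slope_gt0 => //; [exact: Lam_gt0|exact: w1].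
have prop (k l : nat) : (0 < k < 8)%N -> (0 < l < 8)%N ->
    {ae mu, forall x, w k x != 0 -> w l x != 0 ->
      c k * grad (w k) (L k) x = c l * grad (w l) (L l) x}.
  move=> k8 l8; apply: grad_proportional => //; try exact: Lam_gt0; try exact: wL.
  have k01 : 0 <= (k%:R / 8 : R) <= 1 by apply: grid; case/andP: k8 => _ /ltnW.
  have l01 : 0 <= (l%:R / 8 : R) <= 1 by apply: grid; case/andP: l8 => _ /ltnW.
  move=> h mh _.
  apply: (le_trans _ (conv _ _ _ _)); last 2 first.
  - exact: measurable_funD.
  - exact: measurable_funB.
  rewrite (_ : (fun x => _) = W (2^-1 * (k%:R / 8 + l%:R / 8))).
    by rewrite WL -?EFinM ?lee_fin ?mid //; lra.
  by apply/funext => x; rewrite /w /W; field.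
have : {ae mu, forall x, forall k l : nat, (0 < k < 8)%N -> (0 < l < 8)%N ->
    w k x != 0 -> w l x != 0 -> c k * grad (w k) (L k) x = c l * grad (w l) (L l) x}.
  apply: ae_foralln => k; apply: ae_foralln => l.
  have [k8|k8] := boolP (0 < k < 8)%N; last by apply: aeW.
  have [l8|l8] := boolP (0 < l < 8)%N; last by apply: aeW.
  by apply: filterS (prop k l k8 l8) => x h _ _.
move=> aeprop.
pose B x := (g x - f x) / 8.
pose rho x := B x / w 2%N x.
have wE (k : nat) x : w k x = f x + k%:R * B x by rewrite /w /W /B; field.
have aerig : {ae mu, forall x, (f x = 0 /\ B x = 0) \/
  [/\ w 2%N x != 0, 0 < 1 + rho x * 3 &
    forall i, (i < 4)%N -> w i.+2 x = w 2%N x * (1 + rho x * i%:R) /\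
      (1 + rho x * i%:R) `^ (P x - 1) * (c i.+2 / c 2%N) =
      (L i.+2 / L 2%N) `^ (P x * U x)]}.
  apply: filterS aeprop => x px.
  apply: (@pointwise_rigidity R (P x) (U x) (f x) (B x) (w ^~ x) c L).
  - by case/andP: (HP x).
  - by [].
  - move=> k /andP[k0 k7]; have k8 : (0 < k < 8)%N by rewrite k0 ltnW.
    by split; [exact: c_gt0|exact: Lam_gt0].
  - move=> k l /andP[k0 k7] /andP[l0 l7].
    by have := px k l; rewrite k0 l0 (leqW k7) (leqW l7) => /(_ isT isT).
have [Gam GamE] : exists Gam, forall i : nat, Gam i = c i.+2 / c 2%N.
  by exists (fun i => c i.+2 / c 2%N).
have [D DE] : exists D, forall i : nat, D i = dens (w i.+2) (L i.+2).
  by exists (fun i => dens (w i.+2) (L i.+2)).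
pose dlt := (L 3%N - L 2%N) / L 2%N.
have L_gt0 (k : nat) : (0 < k < 8)%N -> 0 < L k by exact: Lam_gt0.
have in8 (i : nat) : (i < 4)%N -> (0 < i.+2 < 8)%N.
  by move=> i4; rewrite /= !ltnS; exact: leq_trans (ltnW i4) _.
have Lmid (k : nat) : (k <= 6)%N -> L k + L k.+2 = 2 * L k.+1.
  move=> k6; rewrite /L mid; [|apply: grid..]; last 2 first.
  - by apply: leq_trans k6 _.
  - by [].
  by congr (2 * Lam _); rewrite -!natr1; field.
have LE i : (i < 4)%N -> L i.+2 / L 2%N = 1 + dlt * i%:R.
  have L2 := L_gt0 2%N isT; have := Lmid 2%N isT; have := Lmid 3%N isT.
  move=> e3 e2; have {e2} e2 : L 4%N = 2 * L 3%N - L 2%N by lra.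
  have {e3} e3 : L 5%N = 3 * L 3%N - 2 * L 2%N by lra.
  by rewrite /dlt; case: i => [|[|[|[|]]]] // _; rewrite ?e2 ?e3; field;
    rewrite gt_eqF.
have aeD i : (i < 4)%N -> {ae mu, forall x, Gam i * D i x = D 0%N x * (1 + rho x * i%:R)}.
  move=> i4; apply: filterS aerig => x [[fx Bx]|[w2 r3 /(_ i i4)[wi powE]]].
    have w0 (k : nat) : w k x = 0 by rewrite wE fx Bx mulr0 addr0.
    by rewrite !DE /dens !w0 normr0 powR0 ?gt_eqF // !mul0r mulr0.
  have r0 : 0 < 1 + rho x * i%:R.
    exact: affine_gt0 r3 i4.
  have [Li L2] : 0 < L i.+2 /\ 0 < L 2%N by split; apply: L_gt0 => //; exact: in8.
  rewrite !DE /dens wi normrM (gtr0_norm r0) (powRM _ (normr_ge0 _) (ltW r0)).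
  set r := 1 + _ in r0 powE *.
  have -> : r `^ P x = r `^ (P x - 1) * r.
    by rewrite -[X in _ * X]powRr1 ?(ltW r0) // -powRD ?subrK // (gt_eqF r0) implybT.
  have -> : L 2%N `^ (- (P x * U x)) =
      (L i.+2 / L 2%N) `^ (P x * U x) * L i.+2 `^ (- (P x * U x)).
    rewrite (powRM _ (ltW Li)) ?invr_ge0 ?(ltW L2) // mulrAC -powRD; last first.
      by rewrite (gt_eqF Li) implybT.
    rewrite subrr powRr0 mul1r -[(L 2%N)^-1]powR_inv1 ?(ltW L2) //.
    by rewrite -powRrM mulN1r.
  by rewrite -powE GamE; ring.
have D1 i : (i < 4)%N -> Psi (w i.+2) (L i.+2) = 1%E by move=> /in8; exact: w1.
have intD i : (i < 4)%N -> \int[mu]_x D i x = 1.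
  by move=> i4; rewrite DE; apply: Rintegral_dens; exact: D1.
have iD i : (i < 4)%N -> mu.-integrable [set: T] (EFin \o D i).
  move=> i4; have iLi := L_gt0 _ (in8 _ i4); rewrite DE.
  have := @integrable_dens_mul _ _ (cst 1) 1 iLi (mw i.+2).
  rewrite (_ : EFin \o (fun x => _ * _) = EFin \o dens (w i.+2) (L i.+2)); last first.
    by apply/funext => x; rewrite /= mulr1.
  by apply => //; [rewrite D1 // ltry|move=> x; rewrite normr1].
have Gam_affine i : (i < 4)%N -> Gam i = 1 + (Gam 1%N - 1) * i%:R.
  move=> i4.
  have : Gam i + - (i%:R * Gam 1%N) + (i%:R - 1) = 0.
    apply: (ae_linear_relation (iD i i4) (iD 1%N isT) (iD 0%N isT)
      (intD i i4) (intD 1%N isT) (intD 0%N isT)).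
    have := aeD i i4; have := aeD 1%N isT; apply: filterS2 => x h1 hi.
    transitivity (Gam i * D i x - i%:R * (Gam 1%N * D 1%N x) + (i%:R - 1) * D 0%N x).
      by ring.
    by rewrite h1 hi; ring.
  move=> h; rewrite -[LHS]subr0 -h; ring.
pose gam := Gam 1%N - 1.
have rigid : {ae mu, forall x, (f x = 0 /\ B x = 0) \/
    (w 2%N x != 0 /\ ((dlt = 0 /\ rho x = 0) \/
     (dlt != 0 /\ (gam = 0 /\ rho x = dlt \/ gam = dlt /\ rho x = 0))))}.
  apply: filterS aerig => x [|[w2 r3 powE]]; [by left|right; split => //].
  apply: (@affine_power_identity R (P x) (U x)) => //.
  - by case/andP: (HP x).
  - by rewrite U_gt0; case/andP: (HU x).
  - by rewrite -Gam_affine // GamE; apply: divr_gt0; exact: c_gt0.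
  - by rewrite -LE //; apply: divr_gt0; exact: L_gt0.
  - have tE i : (i < 4)%N ->
        (1 + rho x * i%:R) `^ (P x - 1) * (1 + gam * i%:R) =
        (1 + dlt * i%:R) `^ (P x * U x).
      by move=> i4; rewrite -Gam_affine // -LE // GamE; exact: (powE i i4).2.
    move=> t; rewrite !inE => /or3P[] /eqP ->.
    + exact: (tE 1%N).
    + exact: (tE 2%N).
    + exact: (tE 3%N).
have [dlt0|dlt_neq0] := eqVneq dlt 0.
  apply: filterS rigid => x fx _; apply/esym/eqP; rewrite -subr_eq0.
  have : B x = 0.
    case: fx => [[]//|[w2 [[_ r0]|[]]]]; last by rewrite dlt0 eqxx.
    by rewrite -[B x](divfK w2) -/(rho x) r0 mul0r.
  by rewrite /B => /eqP; rewrite mulf_eq0 invr_eq0 pnatr_eq0 orbF.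
exfalso.
pose r0 := if gam == 0 then dlt else 0.
have h : 0 + Gam 1%N + - (1 + r0) = 0.
  apply: (ae_linear_relation (iD 0%N isT) (iD 1%N isT) (iD 0%N isT)
    (intD 0%N isT) (intD 1%N isT) (intD 0%N isT)).
  have := aeD 1%N isT; apply: filterS2 rigid => x rx ->.
  case: rx => [[fx Bx]|[w2 [[d0]|[_ rx]]]].
  - have w0 : w 2%N x = 0 by rewrite wE fx Bx mulr0 addr0.
    by rewrite !DE /dens w0 normr0 powR0 ?gt_eqF // !mul0r !mulr0 !addr0.
  - by move: dlt_neq0; rewrite d0 eqxx.
  - have -> : rho x = r0.
      rewrite /r0; case: rx => [[-> ->]|[-> ->]]; first by rewrite eqxx.
      by rewrite (negbTE dlt_neq0).
    ring.
have : gam = r0 by apply/eqP; rewrite -subr_eq0 /gam -[X in _ == X]h; apply/eqP; ring.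
rewrite /r0; have [->|gn0] := eqVneq gam 0.
  by move=> d0; move: dlt_neq0; rewrite -d0 eqxx.
by move=> g0; move: gn0; rewrite g0 eqxx.
Qed.

(** * The mixed space and the convexity of phi *)

Lemma inf_pos_le (A : R -> Prop) (m : R) : 0 < m -> A m -> (inf_pos A <= m%:E)%E.
Proof. by move=> m0 Am; apply: ereal_inf_lbound; exists m. Qed.

Lemma phi0 : phi (fun=> 0) = 0%E.
Proof.
apply/eqP; rewrite eq_le phi_ge0 andbT; apply/lee_addgt0Pr => e e0.
rewrite add0e; apply: phi_le => //.
rewrite /Psi integral0_eq // => x _; rewrite /dens normr0 powR0 ?mul0r //.
by rewrite gt_eqF.
Qed.

Lemma phi_fin_Psi f : measurable_fun [set: T] f -> (phi f < +oo)%E ->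
  (Psi f 1 < +oo)%E.
Proof.
move=> mf foo; pose l := Num.max 1 (fine (phi f)).
have l1 : 1 <= l by rewrite le_max lexx.
have l0 : 0 < l by exact: lt_le_trans l1.
have : (phi f <= l%:E)%E.
  by rewrite -(@fineK _ (phi f)) ?ge0_fin_numE ?phi_ge0 // lee_fin le_max lexx orbT.
move=> /(Psi_le1 l0 mf) fl; have := Psi_grow l1 ltr01 mf; rewrite mulr1 => h.
apply: (le_lt_trans h); apply: (@le_lt_trans _ _ ((l `^ M)%:E * 1)%E).
  by apply: lee_wpmul2l => //; rewrite lee_fin powR_ge0.
by rewrite mule1 ltry.
Qed.

Implicit Types F G : nat -> T -> R.

(** The modular of the mixed space. *)
Definition Phi F : \bar R := (\sum_(0 <= nu <oo) phi (F nu))%E.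

Lemma Phi_ge0 F : (0 <= Phi F)%E.
Proof. by apply: nneseries_ge0 => nu _ _; exact: phi_ge0. Qed.

Lemma Phi_scale F k s : 0 <= s <= k -> 1 <= k ->
  (forall nu, measurable_fun [set: T] (F nu)) ->
  (Phi (fun nu x => s * F nu x)%R <= (k `^ u0^-1)%:E * Phi F)%E.
Proof.
move=> sk k1 mF; rewrite /Phi -nneseriesZl; last by move=> nu _; exact: phi_ge0.
apply: lee_nneseries => nu _; first by move=> _; exact: phi_ge0.
exact: phi_scale.
Qed.

(** The infimum need not be attained a priori, but it provides m < k r for
    every k > 1, and dividing by r instead of m multiplies the modular by at
    most k^(1/u0). *)
Lemma Phi_le1 F r : 0 < r -> (forall nu, measurable_fun [set: T] (F nu)) ->
  (inf_pos (fun m => (Phi (fun nu x => F nu x / m)%R <= 1)%E) <= r%:E)%E ->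
  (Phi (fun nu x => F nu x / r)%R <= 1)%E.
Proof.
move=> r0 mF Fr; apply: (@lee1_of_powR _ _ u0^-1); first by rewrite invr_gt0.
move=> k k1.
have : (inf_pos (fun m => (Phi (fun nu x => F nu x / m)%R <= 1)%E) < (k * r)%:E)%E.
  by apply: (le_lt_trans Fr); rewrite lte_fin ltr_pMl.
move=> /ereal_inf_lt[_ [m [m0 Fm] <-]]; rewrite lte_fin => mkr.
rewrite (_ : (fun nu x => F nu x / r) = fun nu x => m / r * (F nu x / m)); last first.
  by apply/funext => nu; apply/funext => x; field; rewrite !gt_eqF.
have mr : 0 <= m / r <= k.
  by rewrite divr_ge0 ?(ltW m0) ?(ltW r0) //= ler_pdivrMr // ltW.
have mFm nu : measurable_fun [set: T] (fun x => F nu x / m).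
  exact: measurable_funM.
apply: (le_trans (Phi_scale mr (ltW k1) mFm)).
rewrite -[leRHS]mule1; apply: lee_wpmul2l => //.
by rewrite lee_fin powR_ge0.
Qed.

Lemma Phi_eq1 F : (forall nu, measurable_fun [set: T] (F nu)) ->
  inf_pos (fun m => (Phi (fun nu x => F nu x / m)%R <= 1)%E) = 1%E ->
  Phi F = 1%E.
Proof.
move=> mF F1.
have FE : (fun nu x => F nu x / 1) = F.
  by apply/funext => nu; apply/funext => x; rewrite divr1.
have le1 : (Phi F <= 1)%E.
  by have := @Phi_le1 F 1 ltr01 mF; rewrite F1 FE; apply.
apply/eqP; rewrite eq_le le1 /= leNgt; apply/negP => lt1.
have fin : Phi F \is a fin_num.
  by rewrite ge0_fin_numE ?Phi_ge0 // (lt_trans lt1) // ltry.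
pose r := fine (Phi F).
have r0 : 0 <= r by rewrite fine_ge0 ?Phi_ge0.
have r1 : r < 1 by rewrite -lte_fin fineK.
(* Multiplication by k multiplies Phi F by at most k ^ (1 / u0) = 1 / s. *)
pose s := (r + 1) / 2.
have [s0 s1 rs] : [/\ 0 < s, s < 1 & r <= s] by rewrite /s; split; lra.
pose k := s^-1 `^ u0.
have k1 : 1 < k by rewrite powR_gt1 // invf_gt1.
have k0 : 0 < k by exact: lt_trans k1.
have kk : 0 <= k <= k by rewrite (ltW k0) lexx.
have kE : k `^ u0^-1 = s^-1.
  by rewrite /k -powRrM mulfV ?gt_eqF // powRr1 // invr_ge0 ltW.
have := Phi_scale kk (ltW k1) mF; rewrite kE -(fineK fin) -/r -EFinM => h.
have : (inf_pos (fun m => (Phi (fun nu x => F nu x / m)%R <= 1)%E) <= k^-1%:E)%E.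
  apply: inf_pos_le; first by rewrite invr_gt0.
  rewrite (_ : (fun nu x => F nu x / k^-1) = fun nu x => k * F nu x).
    apply: (le_trans h); rewrite lee_fin ler_pdivrMl // mulr1 //.
  by apply/funext => nu; apply/funext => x; rewrite invrK mulrC.
by rewrite F1 lee_fin leNgt invf_lt1 // k1.
Qed.

Lemma nneseries_eq_termwise (u v : nat -> \bar R) :
  (forall i, 0 <= u i)%E -> (forall i, u i <= v i)%E ->
  (\sum_(0 <= i <oo) v i < +oo)%E ->
  (\sum_(0 <= i <oo) u i = \sum_(0 <= i <oo) v i)%E -> forall i, u i = v i.
Proof.
move=> u0' uv voo uvE i; apply/eqP; rewrite eq_le uv /= leNgt; apply/negP => lt_uv.
have v0 j : (0 <= v j)%E by exact: le_trans (u0' j) (uv j).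
move: voo uvE.
rewrite (nneseriesD1 (f := u) (n := i)) // (nneseriesD1 (f := v) (n := i)) //.
set u' := (\sum_(_ <= _ <oo | _) u _)%E; set v' := (\sum_(_ <= _ <oo | _) v _)%E.
have u'v' : (u' <= v')%E by apply: lee_nneseries.
have v'0 : (0 <= v')%E by apply: nneseries_ge0.
move=> voo; apply/eqP; rewrite lt_eqF //.
have v'fin : v' \is a fin_num.
  rewrite ge0_fin_numE //; apply: le_lt_trans voo.
  by rewrite leeDr.
rewrite [ltRHS]addeC [ltLHS]addeC.
apply: (@le_lt_trans _ _ (v' + u i)%E); first by rewrite leeD2r.
by rewrite lteD2lE.
Qed.

Context (p q : T -> \bar R).
Context (mp : measurable_fun [set: T] p) (mq : measurable_fun [set: T] q).
Context (pqE : {ae mu, forall x, p x = (P x)%:E /\ q x = ((U x)^-1)%:E}).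

(** Since p is finite almost everywhere, the part of the modular carried by
    [Omega_infty p] vanishes. *)
Lemma modularE f : measurable_fun [set: T] f -> modular mu p f = Psi f 1.
Proof.
move=> mf; rewrite /modular.
have mO : measurable (Omega_zero p).
  have := emeasurable_neq measurableT mp +oo%E; rewrite setTI.
  congr measurable; apply/seteqP; split => x /=; first by move/eqP.
  by move=> h; apply/eqP.
rewrite [X in (_ + X)%E](_ : _ = 0%E); last first.
  rewrite Lnorm.unlock /=; case: ifP => // mu0.
  apply: abs_ess_sup_eq0 => //.
  apply: filterS pqE => x [px _] _; rewrite patchE memNset //.
  by rewrite /Omega_infty /= px.
rewrite adde0 integral_mkcond; apply: ae_eq_integral => //.
- apply/(measurable_restrictT _ mO); apply/measurable_EFinP.
  apply: measurable_funTS; apply: measurable_powR_fun => //.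
  exact: measurableT_comp.
- by apply/measurable_EFinP; exact: measurable_dens.
apply: filterS pqE => x [px _] _; rewrite patchE mem_set; last first.
  by rewrite /Omega_zero /Omega_infty /= px.
by rewrite px /= /dens powR1 mulr1.
Qed.

Lemma root_exponentE (l : R) (e : \bar R) : root_exponent l e = l `^ (fine e)^-1.
Proof. by case: e => //=; rewrite invr0 powRr0. Qed.

Lemma modular_rootE f l : 0 < l -> measurable_fun [set: T] f ->
  modular mu p (fun x => f x / root_exponent l (q x))%R = Psi f l.
Proof.
move=> l0 mf.
have mr : measurable_fun [set: T] (fun x => f x / root_exponent l (q x)).
  apply: measurable_funM => //; apply: measurable_invr_fun.
  rewrite (_ : (fun x => _) = fun x => l `^ (fine (q x))^-1).
    by apply: measurable_powR_cst => //; apply: measurable_invr_fun; exact: measurableT_comp.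
  by apply/funext => x; rewrite root_exponentE.
rewrite (modularE mr); apply: ae_eq_integral; first exact: measurableT.
- by apply/measurable_EFinP; exact: measurable_dens.
- by apply/measurable_EFinP; exact: measurable_dens.
apply: filterS pqE => x [_ qx] _; congr _%:E.
rewrite /dens root_exponentE qx /= invrK powR1 mulr1 normrM.
rewrite (powRM _ (normr_ge0 _) (normr_ge0 _)); congr (_ * _).
rewrite ger0_norm ?invr_ge0 ?powR_ge0 // -powRN -powRrM mulNr.
by rewrite [U x * _]mulrC.
Qed.

Lemma eq_inf_pos (A B : R -> Prop) : (forall l, 0 < l -> A l <-> B l) ->
  inf_pos A = inf_pos B.
Proof.
move=> AB; congr ereal_inf; apply/seteqP.
by split => _ [l [l0 h] <-]; exists l => //; split => //; apply/AB.
Qed.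

Lemma mixed_modularE F : (forall nu, measurable_fun [set: T] (F nu)) ->
  mixed_modular mu p q F = Phi F.
Proof.
move=> mF; apply: eq_eseriesr => nu _; apply: eq_inf_pos => l l0.
by rewrite modular_rootE.
Qed.

Lemma mixed_normE F : (forall nu, measurable_fun [set: T] (F nu)) ->
  mixed_norm mu p q F = inf_pos (fun m => (Phi (fun nu x => F nu x / m)%R <= 1)%E).
Proof.
move=> mF; apply: eq_inf_pos => l l0; rewrite mixed_modularE // => nu.
exact: measurable_funM.
Qed.

Lemma mixed_space_of_Phi F : (forall nu, measurable_fun [set: T] (F nu)) ->
  (Phi F < +oo)%E -> mixed_space mu p q F.
Proof.
move=> mF Foo.
have FE : (fun nu x => F nu x / 1) = F.
  by apply/funext => nu; apply/funext => x; rewrite divr1.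
split; last by exists 1; split => //; rewrite FE mixed_modularE.
move=> nu; split => //; exists 1; split => //.
rewrite (_ : (fun x => _) = F nu); last by apply/funext => x; rewrite divr1.
rewrite modularE //; apply: phi_fin_Psi => //; apply: le_lt_trans Foo.
rewrite /Phi (nneseriesD1 (n := nu)) //; last by move=> k _; exact: phi_ge0.
by rewrite leeDl // nneseries_ge0 // => k _ _; exact: phi_ge0.
Qed.

Context (V : completeNormedModType R) (cls : (nat -> T -> R) -> V).
Context (hV : is_mixed_banach_space mu p q cls).

Let measurable_mixed F : mixed_space mu p q F ->
  forall nu, measurable_fun [set: T] (F nu).
Proof. by move=> [h _] nu; case: (h nu). Qed.

Lemma normV F : mixed_space mu p q F -> (`|cls F|)%:E =
  inf_pos (fun m => (Phi (fun nu x => F nu x / m)%R <= 1)%E).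
Proof.
move=> SF; have [_ _ _ normE] := hV.
by rewrite -(mixed_normE (measurable_mixed SF)) (normE F SF).
Qed.

(** Convexity of phi from the triangle inequality. After the shift by s^-1,
    where s = phi a + phi b + e, the sequences (a, b, 0, ...) and
    (b, a, 0, ...) are in the unit ball; e > 0 keeps s positive when
    phi a = phi b = 0. *)
Lemma phi_convex (a b : T -> R) :
  measurable_fun [set: T] a -> measurable_fun [set: T] b ->
  (2%:E * phi (fun x => 2^-1 * (a x + b x))%R <= phi a + phi b)%E.
Proof.
move=> ma mb; case: hV => lin _ _ _.
have [aoo|afin] := boolP (phi a == +oo%E).
  rewrite (eqP aoo) addye ?leey // gt_eqF //.
  by rewrite (lt_le_trans _ (phi_ge0 b)).
have [boo|bfin] := boolP (phi b == +oo%E).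
  rewrite (eqP boo) addey ?leey // gt_eqF //.
  by rewrite (lt_le_trans _ (phi_ge0 a)).
have [al aE] : exists al, phi a = al%:E.
  exists (fine (phi a)); rewrite fineK // ge0_fin_numE ?phi_ge0 //.
  by rewrite lt_neqAle afin leey.
have [be bE] : exists be, phi b = be%:E.
  exists (fine (phi b)); rewrite fineK // ge0_fin_numE ?phi_ge0 //.
  by rewrite lt_neqAle bfin leey.
have al0 : 0 <= al by rewrite -lee_fin -aE; exact: phi_ge0.
have be0 : 0 <= be by rewrite -lee_fin -bE; exact: phi_ge0.
have -> : (phi a + phi b = (al + be)%:E)%E by rewrite aE bE.
apply/lee_addgt0Pr => e e0; rewrite -EFinD.
pose s := al + be + e; have s0 : 0 < s by rewrite /s; lra.
have ab_le : (phi a + phi b <= s%:E)%E.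
  by rewrite aE bE -EFinD lee_fin /s lerDl ltW.
have ba_le : (phi b + phi a <= s%:E)%E by rewrite addeC.
have c0 : 0 < s^-1 by rewrite invr_gt0.
pose sh (g : T -> R) x := s^-1 `^ U x * g x.
have msh g : measurable_fun [set: T] g -> measurable_fun [set: T] (sh g).
  by move=> mg; exact: measurable_shift.
have phish g : measurable_fun [set: T] g -> phi (sh g) = (s^-1%:E * phi g)%E.
  by move=> mg; exact: phi_shift.
pose pair (g h : T -> R) (nu : nat) : T -> R :=
  match nu with 0%N => sh g | 1%N => sh h | _ => fun=> 0 end.
have mpair g h : measurable_fun [set: T] g -> measurable_fun [set: T] h ->
    forall nu, measurable_fun [set: T] (pair g h nu).
  by move=> mg mh [|[|nu]] /=; [exact: msh|exact: msh|exact: measurable_cst].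
have Phipair g h : Phi (pair g h) = (phi (sh g) + phi (sh h))%E.
  rewrite /Phi (nneseries_split 0 2); last by move=> k _; exact: phi_ge0.
  rewrite big_nat_recr //= big_nat1 [X in (_ + X)%E](_ : _ = 0%E) ?adde0 //.
  by apply: eseries0 => -[|[|k]] // _ _; exact: phi0.
have Phile1 g h : (phi g + phi h <= s%:E)%E -> measurable_fun [set: T] g ->
    measurable_fun [set: T] h -> (Phi (pair g h) <= 1)%E.
  move=> gh mg mh; rewrite Phipair !phish // -ge0_muleDr ?phi_ge0 //.
  by rewrite lee_pdivrMl // mule1.
have Sab : mixed_space mu p q (pair a b).
  apply: mixed_space_of_Phi; first exact: mpair.
  apply: (@le_lt_trans _ _ 1%E); last exact: ltry.
  exact: (Phile1 a b ab_le ma mb).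
have Sba : mixed_space mu p q (pair b a).
  apply: mixed_space_of_Phi; first exact: mpair.
  apply: (@le_lt_trans _ _ 1%E); last exact: ltry.
  exact: (Phile1 b a ba_le mb ma).
have norm_le1 F : mixed_space mu p q F -> (Phi F <= 1)%E -> `|cls F| <= 1.
  move=> SF F1; rewrite -lee_fin normV //; apply: (inf_pos_le ltr01).
  rewrite (_ : (fun nu x => F nu x / 1) = F) //.
  by apply/funext => nu; apply/funext => x; rewrite divr1.
have nab := norm_le1 _ Sab (Phile1 a b ab_le ma mb).
have nba := norm_le1 _ Sba (Phile1 b a ba_le mb ma).
have [Ssum clsum] := lin 1 _ _ Sab Sba.
have : (Phi (fun nu x => (1 * pair a b nu x + pair b a nu x) / 2)%R <= 1)%E.
  apply: Phi_le1 => //; first exact: measurable_mixed Ssum.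
  rewrite -normV // clsum scale1r lee_fin.
  by apply: (le_trans (ler_normD _ _)); lra.
pose mid x := 2^-1 * (a x + b x).
have mmid : measurable_fun [set: T] mid.
  by apply: measurable_funM => //; exact: measurable_funD.
rewrite (_ : (fun nu x => _) = pair mid mid); last first.
  apply/funext => -[|[|nu]]; apply/funext => x /=; rewrite /sh /mid.
  - by field.
  - by field.
  - by rewrite mulr0 addr0 mul0r.
rewrite Phipair (phish mid mmid) -/mid.
have <- : (2%:E * (s^-1%:E * phi mid) = s^-1%:E * phi mid + s^-1%:E * phi mid)%E.
  by rewrite mule_natl mule2n.
rewrite muleCA lee_pdivrMl // mule1 => /le_trans; apply.
by rewrite lee_fin /s.
Qed.

(** The segment from x to y is on the unit sphere, so that the sums of the
    terms phi (W t nu) are all 1; by convexity each term is midpoint affine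
    in t, and [phi_affine_rigid] applies coordinatewise. *)
Lemma mixed_strictly_convex : strictly_convex V.
Proof.
case: hV => lin surj inj _ x y x1 y1; apply: contra_neqT; rewrite -leNgt => xy2.
have [f Sf fx] := surj x; have [g Sg gy] := surj y.
have mf := measurable_mixed Sf; have mg := measurable_mixed Sg.
pose W (t : R) nu z := f nu z + t * (g nu z - f nu z).
have WV t : mixed_space mu p q (W t) /\ cls (W t) = t *: (y - x) + x.
  have [Sd cd] := lin (-1) _ _ Sf Sg.
  have [St ct] := lin t _ _ Sd Sf.
  have WE : (fun nu z => t * (-1 * f nu z + g nu z) + f nu z) = W t.
    by apply/funext => nu; apply/funext => z; rewrite /W; ring.
  rewrite WE in St ct; split => //.
  by rewrite ct cd fx gy scaleN1r [- x + y]addrC.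
have le1 (t : R) : 0 <= t <= 1 -> `|t *: (y - x) + x| <= 1.
  move=> /andP[t0 t1].
  have -> : t *: (y - x) + x = t *: y + (1 - t) *: x.
    by rewrite scalerBr scalerBl scale1r [x - _]addrC addrA.
  apply: (le_trans (ler_normD _ _)); rewrite !normrZ (ger0_norm t0).
  rewrite ger0_norm ?subr_ge0 //.
  have h1 : t * `|y| <= t * 1 by exact: ler_wpM2l.
  have h2 : (1 - t) * `|x| <= (1 - t) * 1 by apply: ler_wpM2l; rewrite ?subr_ge0.
  lra.
(* The points at times t and 1 - t have sum x + y. *)
have eq1 (t : R) : 0 <= t <= 1 -> `|t *: (y - x) + x| = 1.
  move=> t01; apply/eqP; rewrite eq_le le1 //=.
  have t01' : 0 <= 1 - t <= 1 by lra.
  have := le1 _ t01'.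
  have : 2 <= `|t *: (y - x) + x| + `|(1 - t) *: (y - x) + x|.
    apply: (le_trans xy2); apply: le_trans (ler_normD _ _).
    rewrite addrACA -scalerDl [t + _]addrC subrK scale1r.
    by rewrite addrA subrK [y + x]addrC.
  by move=> ? ?; lra.
have mW t nu : measurable_fun [set: T] (W t nu).
  by have [St _] := WV t; exact: (measurable_mixed St nu).
have PhiW (t : R) : 0 <= t <= 1 -> Phi (W t) = 1%E.
  move=> t01; have [St ct] := WV t; apply: Phi_eq1 => //.
  by rewrite -normV // ct eq1.
have sumW (t : R) : 0 <= t <= 1 -> (\sum_(0 <= nu <oo) phi (W t nu) = 1)%E.
  exact: PhiW.
have phiW (t : R) nu : 0 <= t <= 1 -> phi (W t nu) = (fine (phi (W t nu)))%:E.
  move=> t01; rewrite fineK // ge0_fin_numE ?phi_ge0 //.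
  apply: (@le_lt_trans _ _ 1%E); last exact: ltry.
  rewrite -(PhiW t t01) /Phi (nneseriesD1 (n := nu)) //; last first.
    by move=> k _; exact: phi_ge0.
  by rewrite leeDl // nneseries_ge0 // => k _ _; exact: phi_ge0.
rewrite -fx -gy; apply/(inj _ _ Sf Sg) => nu.
apply: (@phi_affine_rigid (f nu) (g nu) (fun t => fine (phi (W t nu)))
  (mf nu) (mg nu) phi_convex); first by move=> t t01; exact: phiW.
move=> s t s01 t01.
have m01 : 0 <= 2^-1 * (s + t) <= 1 by lra.
have sumst : (\sum_(0 <= i <oo) (phi (W s i) + phi (W t i)) = 2%:E)%E.
  rewrite nneseriesD; [|by move=> *; exact: phi_ge0..].
  transitivity (1 + 1 : \bar R)%E; last by [].
  congr (_ + _)%E.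
    exact: sumW.
  exact: sumW.
have key : (2%:E * phi (W (2^-1 * (s + t))%R nu) = phi (W s nu) + phi (W t nu))%E.
  apply: (@nneseries_eq_termwise
    (fun nu => 2%:E * phi (W (2^-1 * (s + t))%R nu))%E
    (fun nu => phi (W s nu) + phi (W t nu))%E) => [i|i||].
  - by rewrite mule_ge0 // phi_ge0.
  - apply: le_trans (phi_convex (mW s i) (mW t i)).
    rewrite (_ : W _ i = (fun z => 2^-1 * (W s i z + W t i z))) //.
    by apply/funext => z; rewrite /W; field.
  - by rewrite sumst ltry.
  - rewrite sumst nneseriesZl; last by move=> *; exact: phi_ge0.
    by rewrite (sumW _ m01) mule1.
have rhsE : (phi (W s nu) + phi (W t nu) =
    (fine (phi (W s nu)) + fine (phi (W t nu)))%:E)%E.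
  by rewrite EFinD; congr (_ + _)%E; exact: phiW.
have lhsE : (2%:E * phi (W (2^-1 * (s + t))%R nu) =
    (2 * fine (phi (W (2^-1 * (s + t)) nu)))%:E)%E.
  by rewrite EFinM; congr (_ * _)%E; exact: phiW.
exact: esym (EFin_inj (etrans (esym lhsE) (etrans key rhsE))).
Qed.

End exponent_density.

(** * Exponents with finite essential bounds *)

Section essentially_bounded_exponents.
Context d (T : measurableType d) (R : realType) (mu : {measure set T -> \bar R}).

Lemma ae_bounded_exponent (p : T -> \bar R) :
  (1 < ess_inf mu p)%E -> (ess_inf mu p <= ess_sup mu p)%E ->
  (ess_sup mu p < +oo)%E ->
  exists M : R, 2 <= M /\ {ae mu, forall x, exists r, [/\ p x = r%:E, 1 < r & r <= M]}.
Proof.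
move=> inf1 infsup supoo.
have fin : ess_sup mu p \is a fin_num.
  by rewrite ge0_fin_numE // (le_trans _ infsup) // (le_trans _ (ltW inf1)).
exists (Num.max 2 (fine (ess_sup mu p))); split; first by rewrite le_max lexx.
have := ess_inf_le mu p; have := ess_sup_ge mu p; apply: filterS2 => x px1 px2.
have p1 : (1 < p x)%E by exact: lt_le_trans px2.
have pfin : p x \is a fin_num.
  rewrite ge0_fin_numE; first exact: le_lt_trans supoo.
  by rewrite (le_trans _ (ltW p1)).
exists (fine (p x)); split; first by rewrite fineK.
- by rewrite -lte_fin fineK.
- by rewrite le_max -!lee_fin !fineK // px1 orbT.
Qed.

(** The exponents are replaced by functions P and U, equal almost everywhere
    to p and 1/q, that satisfy their bounds at every point. *)
Lemma mixed_strictly_convex_ess (p q : T -> \bar R) (V : completeNormedModType R)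
    (cls : (nat -> T -> R) -> V) :
  measurable_fun [set: T] p -> measurable_fun [set: T] q ->
  (1 < ess_inf mu p)%E -> (ess_inf mu p <= ess_sup mu p)%E ->
  (ess_sup mu p < +oo)%E ->
  (1 < ess_inf mu q)%E -> (ess_inf mu q <= ess_sup mu q)%E ->
  (ess_sup mu q < +oo)%E ->
  is_mixed_banach_space mu p q cls -> strictly_convex V.
Proof.
move=> mp mq p1 p2 p3 q1 q2 q3 hV.
have [M [M2 aep]] := ae_bounded_exponent p1 p2 p3.
have [N [N2 aeq]] := ae_bounded_exponent q1 q2 q3.
have M0 : 0 < M by lra.
have N0 : 0 < N by lra.
have Ni0 : 0 < N^-1 by rewrite invr_gt0.
have Ni1 : N^-1 < 1 by rewrite invf_lt1 //; lra.
pose fp x := fine (p x); pose uq x := (fine (q x))^-1.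
have mfp : measurable_fun [set: T] fp by exact: measurableT_comp.
have muq : measurable_fun [set: T] uq.
  by apply: measurable_invr_fun; exact: measurableT_comp.
pose P x := if (1 < fp x) && (fp x <= M) then fp x else 2.
pose U x := if (N^-1 <= uq x) && (uq x < 1) then uq x else N^-1.
have mP : measurable_fun [set: T] P.
  apply: measurable_fun_ifT => //; apply: measurable_and.
    exact: measurable_fun_ltr.
  exact: measurable_fun_ler.
have mU : measurable_fun [set: T] U.
  apply: measurable_fun_ifT => //; apply: measurable_and.
    exact: measurable_fun_ler.
  exact: measurable_fun_ltr.
have HP x : 1 < P x <= M.
  by rewrite /P; case: ifP => // _; rewrite M2 ltr1n.
have HU x : N^-1 <= U x < 1.
  by rewrite /U; case: ifP => // _; rewrite lexx Ni1.
apply: (@mixed_strictly_convex d T R mu P U M N^-1 mP mU HP HU M0 Ni0 p q mp mq _ V cls hV).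
move: aep aeq; apply: filterS2 => x [r [pr r1 rM]] [s [qs s1 sN]].
have s0 : 0 < s by lra.
split.
  by rewrite /P /fp pr /= r1 rM.
rewrite /U /uq qs /= lef_pV2 // sN invf_lt1 // s1 /=.
by rewrite invrK.
Qed.

End essentially_bounded_exponents.

(** * Strict convexity over Lebesgue measure *)

Unset Implicit Arguments.

Theorem corollary2p8 (R : realType) (n : nat)
    (p q : lebesgue_space R n -> \bar R)
    (hp : variable_exponent p) (hq : variable_exponent q)
    (hp1 : (1 < ess_inf (lebesgue R n) p)%E)
    (hp2 : (ess_inf (lebesgue R n) p <= ess_sup (lebesgue R n) p)%E)
    (hp3 : (ess_sup (lebesgue R n) p < +oo)%E)
    (hq1 : (1 < ess_inf (lebesgue R n) q)%E)
    (hq2 : (ess_inf (lebesgue R n) q <= ess_sup (lebesgue R n) q)%E)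
    (hq3 : (ess_sup (lebesgue R n) q < +oo)%E)
    (V : completeNormedModType R)
    (cls : (nat -> lebesgue_space R n -> R) -> V)
    (hV : is_mixed_banach_space (lebesgue R n) p q cls) :
  strictly_convex V.
Proof.
have [mp _] := hp; have [mq _] := hq.
exact: (mixed_strictly_convex_ess mp mq hp1 hp2 hp3 hq1 hq2 hq3 hV).
Qed.
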